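(* Let $G=(V,\mathcal E)$ be an undirected connected graph on $n$ nodes. For each link $e=\{i,j\}$ let $E_e=e_i-e_j$, and fix a time-delay $\tau\ge0$. For a weight vector $w=(w(e))_{e\in\mathcal E}$, let $L(w)=\sum_{e\in\mathcal E}w(e)E_eE_e^T$. Call $w$ admissible if $w(e)>0$ for all $e$ and $\tau\lambda_n(L(w))<\pi/2$. Consider the dynamics-noise network $$\dot x(t)=-L(w)x(t-\tau)+\xi(t),\qquad y=M_nx,$$ with $\xi_1,\dots,\xi_n$ mutually independent zero-mean Gaussian white noises of intensities $\sigma_1^2,\dots,\sigma_n^2$. Its agent centralities are $$\eta_i(w)=\frac12\big[L^\dagger\cos(\tau L)(M_n-\sin(\tau L))^\dagger\big]_{ii},\qquad L=L(w).$$ Consider the two problems: - (P1) minimize over admissible $w$ the quantity $\max_{i\in V}\eta_i(w)$; - (P2) minimize over admissible $w$ the quantity $\max\{\rho_{ss}(L(w);\tau;\sigma):\ \sigma_i\ge0,\ \sum_{i=1}^n\sigma_i^2=n\}$. Then (P1) and (P2) are equivalent: an admissible weight vector is optimal for (P1) if and only if it is optimal for (P2). That is, minimizing the worst-case agent centrality index is equivalent to designing the network that is most robust against an adversarial noise allocation of bounded total power.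
   Context: Notation: - $M_n=I_n-\frac1n\mathbf1\mathbf1^T$. - $X^\dagger$ is the Moore–Penrose pseudo-inverse. - $\cos(X)$ and $\sin(X)$ are the matrix power-series functions. - $\lambda_n(L)$ is the largest eigenvalue of $L$. The performance is $$\rho_{ss}(L;\tau;\sigma)=\lim_{t\to\infty}\mathbb E[y^Ty]=\frac1{2\pi}\int\mathrm{Tr}[G(j\omega)^HG(j\omega)]d\omega,\qquad G(s)=M_n(sI+e^{-\tau s}L)^{-1}\mathrm{diag}(\sigma_1,\dots,\sigma_n).$$ The centrality index is $\eta_i=\partial\rho_{ss}/\partial\sigma_i^2$. *)

(* Defs.v *)
From HB Require Import structures.
From mathcomp Require Import all_boot all_order all_algebra.
From mathcomp Require Import all_classical all_reals all_analysis.
From mathcomp Require Import complex.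

Set Implicit Arguments.
Unset Strict Implicit.
Unset Printing Implicit Defensive.

Import Order.TTheory GRing.Theory Num.Theory.
Import numFieldNormedType.Exports.
Local Open Scope ring_scope.
Local Open Scope classical_set_scope.
Local Open Scope complex_scope.

Section Defs.
Variable R : realType.

(* ---------- Graphs: n nodes, m links; link e joins (ends e).1 and (ends e).2 ---------- *)
Definition simple_graph (n m : nat) (ends : 'I_m -> 'I_n * 'I_n) : Prop :=
  (forall e, (ends e).1 != (ends e).2) /\
  (forall e f, ends e = ends f \/ ends e = ((ends f).2, (ends f).1) -> e = f).

Definition gadj (n m : nat) (ends : 'I_m -> 'I_n * 'I_n) : rel 'I_n :=
  fun i j => [exists e : 'I_m, (ends e == (i, j)) || (ends e == (j, i))].

Definition connected_graph (n m : nat) (ends : 'I_m -> 'I_n * 'I_n) : Prop :=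
  forall i j : 'I_n, connect (gadj ends) i j.

Definition Ecol (n m : nat) (ends : 'I_m -> 'I_n * 'I_n) (e : 'I_m) : 'cV[R]_n :=
  \col_k ((k == (ends e).1)%:R - (k == (ends e).2)%:R).

Definition lap (n m : nat) (ends : 'I_m -> 'I_n * 'I_n) (w : 'I_m -> R) : 'M[R]_n :=
  \sum_(e < m) w e *: (Ecol ends e *m (Ecol ends e)^T).

Definition lambda_max (n : nat) (L : 'M[R]_n) : R := sup [set a : R | eigenvalue L a].

Definition admissible (n m : nat) (ends : 'I_m -> 'I_n * 'I_n) (tau : R) (w : 'I_m -> R) :=
  (forall e, 0 < w e) /\ tau * lambda_max (lap ends w) < pi / 2.

Definition Mn (n : nat) : 'M[R]_n := 1%:M - (n%:R)^-1 *: const_mx 1.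

Definition mx_cos (n : nat) (X : 'M[R]_n) : 'M[R]_n :=
  \matrix_(i, j) limn (series (fun k => (-1) ^+ k / ((2 * k)`!)%:R * (X ^+ (2 * k)) i j)).
Definition mx_sin (n : nat) (X : 'M[R]_n) : 'M[R]_n :=
  \matrix_(i, j) limn (series (fun k => (-1) ^+ k / ((2 * k).+1`!)%:R * (X ^+ (2 * k).+1) i j)).

Definition is_MP_inverse (n : nat) (A X : 'M[R]_n) : Prop :=
  [/\ A *m X *m A = A, X *m A *m X = X, (A *m X)^T = A *m X & (X *m A)^T = X *m A].
Definition mp_pinv (n : nat) (A : 'M[R]_n) : 'M[R]_n := xget 0 [set X | is_MP_inverse A X].

Definition eta (n m : nat) (ends : 'I_m -> 'I_n * 'I_n) (tau : R) (w : 'I_m -> R) (i : 'I_n) : R :=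
  let L := lap ends w in
  2^-1 * (mp_pinv L *m mx_cos (tau *: L) *m mp_pinv (Mn n - mx_sin (tau *: L))) i i.

Definition transfer (n : nat) (tau : R) (L : 'M[R]_n) (sigma : 'I_n -> R) (om : R)
  : 'M[R[i]]_n :=
  let s : R[i] := Complex 0 om in
  let ez : R[i] := Complex (cos (tau * om)) (- sin (tau * om)) in (* e^{-tau s} *)
  map_mx (fun x => x%:C) (Mn n) *m
    invmx (s%:M + ez *: map_mx (fun x => x%:C) L) *m
    diag_mx (\row_i (sigma i)%:C).

Definition rho_ss (n : nat) (L : 'M[R]_n) (tau : R) (sigma : 'I_n -> R) : \bar R :=
  ((2 * pi)^-1)%:E *
  (\int[@lebesgue_measure R]_(om in [set: R])
     (complex.Re (\tr ((map_mx conjc (transfer tau L sigma om))^T *m transfer tau L sigma om)))%:E)%E.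

Definition noise_set (n : nat) : set ('I_n -> R) :=
  [set s | (forall i, 0 <= s i) /\ \sum_(i < n) s i ^+ 2 = n%:R].

Definition max_eta (n m : nat) (ends : 'I_m -> 'I_n * 'I_n) (tau : R) (w : 'I_m -> R) : R :=
  sup (range (eta ends tau w)).

Definition worst_rho (n m : nat) (ends : 'I_m -> 'I_n * 'I_n) (tau : R) (w : 'I_m -> R) : \bar R :=
  ereal_sup [set rho_ss (lap ends w) tau s | s in @noise_set n].

Definition P1_optimal (n m : nat) (ends : 'I_m -> 'I_n * 'I_n) (tau : R) (w : 'I_m -> R) :=
  admissible ends tau w /\
  forall w', admissible ends tau w' -> max_eta ends tau w <= max_eta ends tau w'.

Definition P2_optimal (n m : nat) (ends : 'I_m -> 'I_n * 'I_n) (tau : R) (w : 'I_m -> R) :=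
  admissible ends tau w /\
  forall w', admissible ends tau w' -> (worst_rho ends tau w <= worst_rho ends tau w')%E.

End Defs.

(* Main.v *)
(** Diagonalising the Laplacian, L = sum_l l P_l, splits both sides into modes: the trace of
    G^H G at frequency u is the sum over the nonzero eigenvalues l of
    (sum_j sigma_j^2 (P_l)_jj) / |i u + l exp (- i tau u)|^2, and eta_j is half the sum of
    (P_l)_jj cos (tau l) / (l (1 - sin (tau l))).  Hence rho_ss = sum_j sigma_j^2 eta_j as soon as
      int du / (1 + u^2 - 2 u sin (a u)) = pi cos a / (1 - sin a)   for 0 <= a < pi / 2,
    and maximising a linear form over sum_j sigma_j^2 = n gives worst_rho = n * max_eta.

    For the integral put q = exp (- a s), phi = (q - s) / (q + s) and
    al = cos a / (2 (1 - sin a)).  On s = i u the real part of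
      (phi / 2 + al s) / (1 + s^2) - al / (1 + s)
    is 1 / (2 (1 + u^2 - 2 u sin (a u))) - al / (1 + u^2).  This function is O(1 / |s|^2) and
    holomorphic on Re s >= 0, because q + s has no zero there and al cancels the poles at s = i
    and s = - i, so its integral along the imaginary axis vanishes.  The removable singularities
    are avoided by replacing 1 + s^2 with 1 + (s + e)^2 and letting e tend to 0. *)
Require Import Defs.
From HB Require Import structures.
From mathcomp Require Import all_boot all_order all_algebra.
From mathcomp Require Import all_classical all_reals all_analysis.
From mathcomp Require Import complex.
From mathcomp Require Import sesquilinear spectral measurable_realfun ring lra.
Local Open Scope ring_scope.
Set Implicit Arguments.
Unset Strict Implicit.
Unset Printing Implicit Defensive.
Import Order.TTheory GRing.Theory Num.Theory.
Import numFieldNormedType.Exports.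
Import ComplexField.Normc.
Local Open Scope classical_set_scope.
Local Open Scope complex_scope.
Local Notation Re := complex.Re.
Local Notation Im := complex.Im.

(** * Holomorphic functions on the right half-plane *)

Section HalfPlane.
Context {R : realType}.
Implicit Types (f g : R -> R -> R[i]) (c u : R).

(** Functions of s = c + i u are handled in the real coordinates (c, u). The four partial
    derivatives make [f'] the complex derivative, so the Cauchy-Riemann equations are built in. *)
Definition cderiv f f' c u : Prop :=
  [/\ is_derive c 1 (fun x => Re (f x u)) (Re (f' c u)),
      is_derive c 1 (fun x => Im (f x u)) (Im (f' c u)),
      is_derive u 1 (fun y => Re (f c y)) (- Im (f' c u)) &
      is_derive u 1 (fun y => Im (f c y)) (Re (f' c u))].

Lemma ReD (x y : R[i]) : Re (x + y) = Re x + Re y.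
Proof. by case: x; case: y. Qed.
Lemma ImD (x y : R[i]) : Im (x + y) = Im x + Im y.
Proof. by case: x; case: y. Qed.
Lemma ReM (x y : R[i]) : Re (x * y) = Re x * Re y - Im x * Im y.
Proof. by case: x; case: y. Qed.
Lemma ImM (x y : R[i]) : Im (x * y) = Re x * Im y + Im x * Re y.
Proof. by case: x; case: y. Qed.
Lemma ReV (x : R[i]) : Re x^-1 = Re x / (Re x ^+ 2 + Im x ^+ 2).
Proof. by case: x. Qed.
Lemma ImV (x : R[i]) : Im x^-1 = - (Im x / (Re x ^+ 2 + Im x ^+ 2)).
Proof. by case: x. Qed.

Lemma cderiv_cst (k : R[i]) c u : cderiv (fun _ _ => k) (fun _ _ => 0) c u.
Proof. by split; rewrite /= ?oppr0; exact: is_derive_cst. Qed.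

Lemma cderiv_id c u : cderiv (fun c u => Complex c u) (fun _ _ => 1) c u.
Proof. by split; rewrite /= ?oppr0; [exact: is_derive_id|exact: is_derive_cst..|exact: is_derive_id]. Qed.

Lemma cderivD f f' g g' c u : cderiv f f' c u -> cderiv g g' c u ->
  cderiv (fun c u => f c u + g c u) (fun c u => f' c u + g' c u) c u.
Proof.
move=> [f1 f2 f3 f4] [g1 g2 g3 g4]; split.
- under eq_fun do rewrite ReD.
  by rewrite ReD; exact: is_deriveD.
- under eq_fun do rewrite ImD.
  by rewrite ImD; exact: is_deriveD.
- under eq_fun do rewrite ReD.
  by rewrite ImD opprD; exact: is_deriveD.
- under eq_fun do rewrite ImD.
  by rewrite ReD; exact: is_deriveD.
Qed.

Lemma cderivM f f' g g' c u : cderiv f f' c u -> cderiv g g' c u ->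
  cderiv (fun c u => f c u * g c u)
         (fun c u => f' c u * g c u + f c u * g' c u) c u.
Proof.
move=> [f1 f2 f3 f4] [g1 g2 g3 g4]; split.
- under eq_fun do rewrite ReM.
  apply: (is_derive_eq (is_deriveB (is_deriveM f1 g1) (is_deriveM f2 g2))).
  by rewrite ReD !ReM /GRing.scale /=; ring.
- under eq_fun do rewrite ImM.
  apply: (is_derive_eq (is_deriveD (is_deriveM f1 g2) (is_deriveM f2 g1))).
  by rewrite ImD !ImM /GRing.scale /=; ring.
- under eq_fun do rewrite ReM.
  apply: (is_derive_eq (is_deriveB (is_deriveM f3 g3) (is_deriveM f4 g4))).
  by rewrite ImD !ImM /GRing.scale /=; ring.
- under eq_fun do rewrite ImM.
  apply: (is_derive_eq (is_deriveD (is_deriveM f3 g4) (is_deriveM f4 g3))).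
  by rewrite ReD !ReM /GRing.scale /=; ring.
Qed.

Lemma sqr_normc_gt0 (z : R[i]) : z != 0 -> 0 < Re z ^+ 2 + Im z ^+ 2.
Proof.
case: z => a b; rewrite eq_complex /= negb_and => /orP[] h.
- by rewrite ltr_pwDl ?sqr_ge0// exprn_even_gt0.
- by rewrite ltr_wpDl ?sqr_ge0// exprn_even_gt0.
Qed.

Lemma cderivV f f' c u : f c u != 0 -> cderiv f f' c u ->
  cderiv (fun c u => (f c u)^-1) (fun c u => - f' c u * (f c u)^-1 * (f c u)^-1) c u.
Proof.
move=> /sqr_normc_gt0 n0 [f1 f2 f3 f4].
have d1 := is_deriveD (is_deriveX 2 f1) (is_deriveX 2 f2).
have d2 := is_deriveD (is_deriveX 2 f3) (is_deriveX 2 f4).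
have n0' : Re (f c u) ^+ 2 + Im (f c u) ^+ 2 != 0 by rewrite gt_eqF.
have v1 := @is_deriveV R (fun x => Re (f x u) ^+ 2 + Im (f x u) ^+ 2) c _ 1 n0' d1.
have v2 := @is_deriveV R (fun x => Re (f c x) ^+ 2 + Im (f c x) ^+ 2) u _ 1 n0' d2.
have ReN (z : R[i]) : Re (- z) = - Re z by case: z.
have ImN (z : R[i]) : Im (- z) = - Im z by case: z.
split.
- under eq_fun do rewrite ReV.
  refine (is_derive_eq (is_deriveM f1 v1) _).
  by rewrite ?(ReM, ImM) ?(ReV, ImV) ReN ImN /GRing.scale /=; field.
- under eq_fun do rewrite ImV.
  refine (is_derive_eq (is_deriveN (is_deriveM f2 v1)) _).
  by rewrite ?(ReM, ImM) ?(ReV, ImV) ReN ImN /GRing.scale /=; field.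
- under eq_fun do rewrite ReV.
  refine (is_derive_eq (is_deriveM f3 v2) _).
  by rewrite ?(ReM, ImM) ?(ReV, ImV) ReN ImN /GRing.scale /=; field.
- under eq_fun do rewrite ImV.
  refine (is_derive_eq (is_deriveN (is_deriveM f4 v2)) _).
  by rewrite ?(ReM, ImM) ?(ReV, ImV) ReN ImN /GRing.scale /=; field.
Qed.

(* [expN a c u] is exp (- a s) at s = c + i u. *)
Definition expN (a : R) c u : R[i] :=
  Complex (expR (- (a * c)) * cos (a * u)) (- (expR (- (a * c)) * sin (a * u))).

Lemma cderiv_expN (a : R) c u :
  cderiv (expN a) (fun c u => Complex (- a) 0 * expN a c u) c u.
Proof.
have dl (x : R) : is_derive x 1 (fun x => a * x) a.
  by apply: (is_derive_eq (is_deriveZ a (is_derive_id x 1))); rewrite /GRing.scale /= mulr1.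
have de (x : R) := @is_derive1_comp R expR (fun x => - (a * x)) x _ _ (is_derive_expR _) (is_deriveN (dl x)).
have dc (x : R) := @is_derive1_comp R cos (fun x => a * x) x _ _ (is_derive_cos _) (dl x).
have ds (x : R) := @is_derive1_comp R sin (fun x => a * x) x _ _ (is_derive_sin _) (dl x).
split; rewrite ?ReM ?ImM /=.
- apply: (is_derive_eq (is_deriveM (de c) (is_derive_cst (cos (a * u)) c 1))).
  by rewrite /GRing.scale /=; ring.
- apply: (is_derive_eq (is_deriveN (is_deriveM (de c) (is_derive_cst (sin (a * u)) c 1)))).
  by rewrite /GRing.scale /=; ring.
- apply: (is_derive_eq (is_deriveM (is_derive_cst (expR (- (a * c))) u 1) (dc u))).
  by rewrite /GRing.scale /=; ring.
- apply: (is_derive_eq (is_deriveN (is_deriveM (is_derive_cst (expR (- (a * c))) u 1) (ds u)))).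
  by rewrite /GRing.scale /=; ring.
Qed.

End HalfPlane.

(** * Cauchy's theorem on rectangles, with [p] and [q] the real and imaginary parts *)

Section Cauchy.
Context {R : realType}.
Notation mu := (@lebesgue_measure R).

Lemma is_derive_continuous (f : R -> R) (x d : R) :
  is_derive x 1 f d -> {for x, continuous f}.
Proof.
by move=> fd; apply/differentiable_continuous/derivable1_diffP; case: fd.
Qed.

Lemma continuous_itv_integrable (f : R -> R) (a b : R) : continuous f ->
  mu.-integrable `[a, b] (EFin \o f).
Proof.
move=> cf; apply: continuous_compact_integrable; first exact: segment_compact.
exact: continuous_subspaceT.
Qed.

Variables (p q p' : R -> R -> R) (B M : R).
Hypothesis dp : forall c u : R, 0 < c -> is_derive c 1 (p ^~ u) (p' c u).
Hypothesis dq : forall c u : R, 0 < c -> is_derive u 1 (q c) (p' c u).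
Hypothesis cp : forall c : R, 0 < c -> continuous (p c).
Hypothesis cp' : forall c : R, 0 < c -> continuous (p' c).
Hypothesis bp' : forall c u : R, 0 < c -> `|p' c u| <= M.
Hypothesis bp : forall c u : R, 0 < c -> `|p c u| <= B / (1 + c ^+ 2 + u ^+ 2).
Hypothesis bq : forall c u : R, 0 < c -> `|q c u| <= B / (1 + c ^+ 2 + u ^+ 2).

(** After differentiation under the integral sign, the integrand [p'] is also the [u]-derivative of
    [q] by Cauchy-Riemann, so the fundamental theorem of calculus leaves boundary values of [q]. *)
Lemma is_derive_strip_integral (N c : R) : 0 < N -> 0 < c ->
  is_derive c 1 (fun c => \int[mu]_(u in `[- N, N]) p c u) (q c N - q c (- N)).
Proof.
move=> N0 c0.
have M0 : 0 <= M by apply: le_trans (bp' 0 c0).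
have Ic : `](c / 2), (c + 1)[%classic c by rewrite /= in_itv /=; apply/andP; split; lra.
have Ipos x : `](c / 2), (c + 1)[%classic x -> 0 < x.
  by rewrite /= in_itv /= => /andP[h _]; apply: lt_trans h; lra.
have pint x : `](c / 2), (c + 1)[%classic x -> mu.-integrable `[- N, N] (EFin \o p x).
  by move=> /Ipos x0; apply: continuous_itv_integrable; exact: cp.
have pder x y : `](c / 2), (c + 1)[%classic x -> `[- N, N] y -> derivable (p ^~ y) x 1.
  by move=> /Ipos x0 _; have [] := dp y x0.
have pub x y : `](c / 2), (c + 1)[%classic x -> `[- N, N] y ->
    `|partial1of2 p x y| <= cst M y.
  by move=> /Ipos x0 _; rewrite partial1of2E; have [_ ->] := dp y x0; exact: bp'.
have iM : mu.-integrable `[- N, N] (EFin \o cst M).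
  by apply: continuous_itv_integrable => x; exact: cvg_cst.
split.
  exact: (@derivable_under_integral R _ _ mu p `[- N, N] (measurable_itv _)
    c (c / 2) (c + 1) Ic pint pder (cst M) (fun _ => M0) iM pub).
rewrite -derive1E.
rewrite (@differentiation_under_integral R _ _ mu p `[- N, N] (measurable_itv _)
    c (c / 2) (c + 1) Ic pint pder (cst M) (fun _ => M0) iM pub).
have -> : (fun y => (partial1of2 p ^~ y) c) = p' c.
  by apply/funext => y; rewrite partial1of2E; have [_ ->] := dp y c0.
have cq : continuous (q c).
  by move=> u; apply: is_derive_continuous (dq u c0).
rewrite /Rintegral (@continuous_FTC2 _ _ (q c))//.
- lra.
- by apply: continuous_subspaceT; exact: cp'.
- split.
  + by move=> x _; have [] := dq x c0.
  + by apply: cvg_at_right_filter; exact: cq.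
  + by apply: cvg_at_left_filter; exact: cq.
- by move=> x _; rewrite derive1E; have [_ ->] := dq x c0.
Qed.

(* Cauchy's theorem on the rectangle [c, c + N] x [- N, N], bounding the other three sides. *)
Lemma strip_integral_bound (N c : R) : 0 < N -> 0 < c ->
  `|\int[mu]_(u in `[- N, N]) p c u| <= 4 * B / N.
Proof.
move=> N0 c0; pose K c := \int[mu]_(u in `[- N, N]) p c u.
have B0 : 0 <= B.
  have := le_trans (normr_ge0 _) (bp 0 c0).
  rewrite pmulr_lge0// invr_gt0; have := sqr_ge0 c; nra.
have dK (x : R) : 0 < x -> is_derive x 1 K (q x N - q x (- N)).
  exact: is_derive_strip_integral.
have bN (x u : R) : 0 < x -> N <= `|u| -> B / (1 + x ^+ 2 + u ^+ 2) <= B / N ^+ 2.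
  move=> x0 Nu; apply: ler_wpM2l => //; rewrite lef_pV2 ?posrE ?exprn_gt0//.
    have : N ^+ 2 <= u ^+ 2 by rewrite -(real_normK (num_real u)) lerXn2r ?nnegrE// ltW.
    by have := sqr_ge0 x; lra.
  by have := sqr_ge0 x; have := sqr_ge0 u; lra.
have dKle (x : R) : 0 < x -> `|q x N - q x (- N)| <= 2 * B / N ^+ 2.
  move=> x0; apply: le_trans (ler_normB _ _) _.
  have h1 := le_trans (bq N x0) (@bN x N x0 _).
  have h2 := le_trans (bq (- N) x0) (@bN x (- N) x0 _).
  have := h1 (ler_norm _); have := h2 _; rewrite normrN => /(_ (ler_norm _)).
  by rewrite -mulrA; lra.
(* The mean value theorem accounts for the two horizontal sides: between c and c + N, [K] varies by
   N times a difference of values of [q] at heights N and - N, hence by at most 2 B / N. *)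
have [x /[!in_itv]/= /andP[cx _] Kx] := @MVT R K (fun x => q x N - q x (- N)) c (c + N)
    (ltac:(lra)) (fun x hx => dK x (ltac:(move: hx; rewrite in_itv /= => /andP[h _]; lra)))
    (ltac:(apply: continuous_in_subspaceT => y; rewrite inE /= in_itv /= => /andP[h _];
       apply: is_derive_continuous (dK y _); lra)).
have Kc : K c = K (c + N) - (q x N - q x (- N)) * N.
  by rewrite -[X in _ * X](addKr c N) [- c + _]addrC -Kx; ring.
have cN0 : 0 < c + N by lra.
(* On the far side Re s = c + N the integrand is at most B / N^2, over a length 2 N. *)
have KN : `|K (c + N)| <= 2 * B / N.
  apply: le_trans (@le_normr_Rintegral _ _ _ mu _ _ _ _) _ => //.
    by apply: continuous_itv_integrable; exact: cp.
  have Ni : (\int[mu]_(u in `[- N, N]) cst (B / N ^+ 2) u) = 2 * B / N.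
    rewrite Rintegral_cst// /mu/= lebesgue_measure_itv/= lte_fin gtrN// /=.
    by field; rewrite gt_eqF.
  rewrite -Ni; apply: le_Rintegral => //.
  - apply: continuous_itv_integrable => y.
    by apply: continuous_comp; [exact: cp|exact: norm_continuous].
  - by apply: continuous_itv_integrable => y; exact: cvg_cst.
  - move=> u _; apply: le_trans (bp u cN0) _.
    apply: ler_wpM2l => //; rewrite lef_pV2 ?posrE ?exprn_gt0//.
      have : N ^+ 2 <= (c + N) ^+ 2 by rewrite lerXn2r ?nnegrE//; lra.
      by have := sqr_ge0 u; lra.
    by have := sqr_ge0 u; have := sqr_ge0 (c + N); lra.
rewrite -/(K c) Kc; apply: le_trans (ler_normB _ _) _.
rewrite normrM (gtr0_norm N0).
have : `|q x N - q x (- N)| * N <= 2 * B / N ^+ 2 * N.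
  by apply: ler_wpM2r; [exact: ltW|apply: dKle; lra].
have -> : 2 * B / N ^+ 2 * N = 2 * B / N by field; rewrite gt_eqF.
by move: KN; rewrite -!mulrA; lra.
Qed.

End Cauchy.

(** * From symmetric intervals to the whole real line *)

Section Line.
Context {R : realType}.
Notation mu := (@lebesgue_measure R).

Lemma integralT_oneDsqrV :
  (\int[mu]_x ((oneDsqr x)^-1)%:E = (pi : R)%:E)%E.
Proof.
rewrite (@ge0_symfun_integralT R (fun x => (oneDsqr x)^-1)).
- rewrite -set_itvcy integral0y_oneDsqr -EFinM; congr (_%:E).
  by field.
- by move=> x; rewrite invr_ge0.
- exact: continuous_oneDsqrV.
- by move=> x /=; rewrite /oneDsqr sqrrN.
Qed.

Lemma integrable_oneDsqrV (B : R) : mu.-integrable setT (fun x => (B * (oneDsqr x)^-1)%:E).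
Proof.
have i1 : mu.-integrable setT (fun x => ((oneDsqr x)^-1 : R)%:E).
  apply/integrableP; split.
    apply/measurable_EFinP; apply: continuous_measurable_fun.
    exact: continuous_oneDsqrV.
  under eq_integral do rewrite gee0_abs ?lee_fin ?invr_ge0//.
  by rewrite integralT_oneDsqrV ltry.
under eq_fun do rewrite EFinM.
exact: integrableZl.
Qed.

Lemma dominated_integrable (g : R -> R) (B : R) : measurable_fun setT g ->
  (forall u, `|g u| <= B * (oneDsqr u)^-1) -> mu.-integrable setT (EFin \o g).
Proof.
move=> mg gB; apply: le_integrable (integrable_oneDsqrV B) => //.
  exact/measurable_EFinP.
move=> x _ /=; rewrite lee_fin; apply: le_trans (gB x) _; exact: ler_norm.
Qed.

(** The truncations of [g] to [- (n + 1), n + 1] are dominated by a multiple of 1 / (1 + u^2), so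
    their integrals tend to the full one, while the bound [C / N] forces them to 0. *)
Lemma integralT_eq0 (g : R -> R) (B C : R) : continuous g ->
  (forall u, `|g u| <= B * (oneDsqr u)^-1) ->
  (forall N, 0 < N -> `|\int[mu]_(u in `[- N, N]) g u| <= C / N) ->
  (\int[mu]_u (g u)%:E = 0)%E.
Proof.
move=> cg gB gC.
have mg : measurable_fun setT g by exact: continuous_measurable_fun.
pose I (n : nat) : set R := `[- n.+1%:R, n.+1%:R]%classic.
have mI n : measurable (I n) by exact: measurable_itv.
have mgE : measurable_fun setT (EFin \o g) by exact/measurable_EFinP.
have mgI n : measurable_fun setT (EFin \o (g \_ (I n))).
  by apply/measurable_EFinP/(measurable_restrictT g (mI n)); exact: measurable_funTS.
have gI : {ae mu, forall x, [set: R] x -> (EFin \o (g \_ (I n))) x @[n --> \oo] --> (EFin \o g) x}.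
  apply: aeW => x _; apply: cvg_near_cst; near=> n.
  rewrite /= patchE mem_set//= /I /= in_itv /= -ler_norml.
  near: n; have [m _ hm] := @nbhs_infty_ger R `|x|.
  by exists m => // n mn /=; apply: le_trans (hm n mn) _; rewrite ler_nat.
have gIB : {ae mu, forall x n, [set: R] x ->
    (`|(EFin \o (g \_ (I n))) x| <= (B * (oneDsqr x)^-1)%:E)%E}.
  apply: aeW => x n _; rewrite /= lee_fin patchE.
  by case: ifP => _; [exact: gB|rewrite normr0; exact: le_trans (gB x)].
have [_ _ cv] := @dominated_convergence _ _ _ mu setT measurableT _ _ _ mgI mgE gI
  (integrable_oneDsqrV B) gIB.
have c0 : (\int[mu]_x ((EFin \o (g \_ (I n))) x))%E @[n --> \oo] --> (0 : R)%:E.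
  have E n : (\int[mu]_x ((EFin \o (g \_ (I n))) x))%E =
      (\int[mu]_(u in I n) g u)%:E.
    rewrite -restrict_EFin -integral_mkcond /Rintegral fineK//.
    apply: integrable_fin_num => //.
    - exact: mI.
    - exact: (@continuous_itv_integrable R g (- n.+1%:R) n.+1%:R cg).
  under eq_fun do rewrite E.
  apply: cvg_EFin; first by near=> n.
  apply/cvgr0Pnorm_le => e e0.
  near=> n => /=.
  apply: le_trans (gC n.+1%:R _) _; first by rewrite ltr0n.
  rewrite ler_pdivrMr ?ltr0n// mulrC -ler_pdivrMr//.
  near: n; have [m _ hm] := @nbhs_infty_ger R (C / e).
  exists m => // n mn /=; apply: le_trans (hm n mn) _.
  by rewrite ler_nat.
by apply: cvg_unique cv c0.
Unshelve. all: end_near. Qed.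

End Line.

(** * Vanishing integrals along vertical lines and the imaginary axis *)

Section HalfPlaneIntegral.
Context {R : realType}.
Notation mu := (@lebesgue_measure R).
Variables f f' f'' : R -> R -> R[i].
Hypothesis df : forall c u : R, 0 <= c -> cderiv f f' c u.
Hypothesis df' : forall c u : R, 0 < c -> cderiv f' f'' c u.
Variables B M : R.
Hypothesis bf' : forall c u : R, 0 < c -> normc (f' c u) <= M.
Hypothesis bf : forall c u : R, 0 < c -> normc (f c u) <= B / (1 + c ^+ 2 + u ^+ 2).

Lemma Re_le_normc (z : R[i]) : `|Re z| <= normc z.
Proof.
case: z => a b /=; rewrite -sqrtr_sqr ler_wsqrtr// lerDl sqr_ge0//.
Qed.

Lemma Im_le_normc (z : R[i]) : `|Im z| <= normc z.
Proof.
case: z => a b /=; rewrite -sqrtr_sqr ler_wsqrtr// lerDr sqr_ge0//.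
Qed.

Let continuous_Re c : 0 <= c -> continuous (fun u => Re (f c u)).
Proof. by move=> c0 u; have [_ _ h _] := df u c0; exact: is_derive_continuous h. Qed.

Let bRe c u : 0 < c -> `|Re (f c u)| <= B * (oneDsqr u)^-1.
Proof.
move=> c0; have B0 : 0 <= B.
  have := le_trans (normr_ge0 _) (le_trans (Re_le_normc _) (bf 0 c0)).
  rewrite pmulr_lge0// invr_gt0; have := sqr_ge0 c; nra.
apply: le_trans (Re_le_normc _) _; apply: le_trans (bf u c0) _.
apply: ler_wpM2l => //; rewrite /oneDsqr lef_pV2 ?posrE.
- by have := sqr_ge0 c; lra.
- by have := sqr_ge0 c; have := sqr_ge0 u; lra.
- by have := sqr_ge0 u; lra.
Qed.

Lemma half_plane_line_integral c : 0 < c -> (\int[mu]_u (Re (f c u))%:E = 0)%E.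
Proof.
move=> c0; apply: (@integralT_eq0 R _ B (4 * B)).
- by apply: continuous_Re; exact: ltW.
- by move=> u; exact: bRe.
- move=> N N0.
  apply: (@strip_integral_bound R (fun c u => Re (f c u)) (fun c u => Im (f c u))
    (fun c u => Re (f' c u)) B M) => //.
  + by move=> x u x0; have [] := df u (ltW x0).
  + by move=> x u x0; have [] := df u (ltW x0).
  + by move=> x x0; apply: continuous_Re; exact: ltW.
  + by move=> x x0 u; have [_ _ h _] := df' u x0; exact: is_derive_continuous h.
  + by move=> x u x0; apply: le_trans (bf' u x0); exact: Re_le_normc.
  + by move=> x u x0; apply: le_trans (bf u x0); exact: Re_le_normc.
  + by move=> x u x0; apply: le_trans (bf u x0); exact: Im_le_normc.
Qed.

(** The decay bound is assumed for positive abscissas only, so the axis is reached as the limit of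
    the lines c = 1 / (n + 1), with one dominating function for all of them. *)
Lemma imaginary_axis_integral : (\int[mu]_u (Re (f 0 u))%:E = 0)%E.
Proof.
have m c : 0 <= c -> measurable_fun setT (fun u => (Re (f c u))%:E).
  move=> c0; apply/measurable_EFinP; apply: continuous_measurable_fun.
  exact: continuous_Re.
pose e (n : nat) : R := n.+1%:R^-1.
have e0 n : 0 < e n by rewrite invr_gt0 ltr0n.
have fe : {ae mu, forall u, [set: R] u -> (Re (f (e n) u))%:E @[n --> \oo] --> (Re (f 0 u))%:E}.
  apply: aeW => u _; apply: cvg_EFin; first by near=> n.
  have [h _ _ _] := @df 0 u (lexx _).
  apply: (@cvg_comp _ _ _ e (fun c => Re (f c u)) _ (nbhs (0 : R)) _ _ (is_derive_continuous h)).
  exact: cvg_harmonic.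
have feB : {ae mu, forall u n, [set: R] u ->
    (`|(Re (f (e n) u))%:E| <= (B * (oneDsqr u)^-1)%:E)%E}.
  by apply: aeW => x n _; rewrite lee_fin; exact: bRe.
have [_ _ cv] := @dominated_convergence _ _ _ mu setT measurableT _ _ _ (fun n => m _ (ltW (e0 n)))
  (m _ (lexx _)) fe (integrable_oneDsqrV B) feB.
have c0 : (\int[mu]_u (Re (f (e n) u))%:E)%E @[n --> \oo] --> (0 : R)%:E.
  by under eq_fun do rewrite half_plane_line_integral//; exact: cvg_cst.
by apply: cvg_unique cv c0.
Unshelve. all: end_near. Qed.

End HalfPlaneIntegral.
(** * The delay integral *)

Section BoundedHalfPlane.
Context {R : realType}.

Definition hbounded (f : R -> R -> R[i]) :=
  exists M, forall c u : R, 0 <= c -> normc (f c u) <= M.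

Lemma normc_ge0 (z : R[i]) : 0 <= normc z.
Proof. by apply: le_trans (Re_le_normc z). Qed.

Lemma hbounded_cst (k : R[i]) : hbounded (fun _ _ => k).
Proof. by exists (normc k). Qed.

Lemma hboundedD f g : hbounded f -> hbounded g -> hbounded (fun c u => f c u + g c u).
Proof.
move=> [M fM] [N gN]; exists (M + N) => c u c0.
by apply: le_trans (le_normcD _ _) _; apply: lerD; [exact: fM|exact: gN].
Qed.

Lemma hboundedM f g : hbounded f -> hbounded g -> hbounded (fun c u => f c u * g c u).
Proof.
move=> [M fM] [N gN]; exists (M * N) => c u c0.
by rewrite normcM; apply: ler_pM; [exact: normc_ge0..|exact: fM|exact: gN].
Qed.

Lemma cderiv_affineV (k : R[i]) (c u : R) : Complex c u + k != 0 ->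
  cderiv (fun c u => (Complex c u + k)^-1)
         (fun c u => (- 1) * ((Complex c u + k)^-1 * (Complex c u + k)^-1)) c u.
Proof.
move=> h; have := cderivV h (cderivD (cderiv_id c u) (cderiv_cst k c u)).
move=> [h1 h2 h3 h4].
have E : - (1 + 0 : R[i]) * (Complex c u + k)^-1 * (Complex c u + k)^-1
   = (- 1) * ((Complex c u + k)^-1 * (Complex c u + k)^-1) by rewrite addr0 mulrA.
by split; rewrite -E.
Qed.

(** On the half-plane the real part of s + k is at least Re k. *)
Lemma affineV_bounded (k : R[i]) : 0 < Re k ->
  forall c u : R, 0 <= c ->
    Complex c u + k != 0 /\ normc (Complex c u + k)^-1 <= (Re k)^-1.
Proof.
case: k => x y; rewrite -[Re _]/x => x0 c u c0.
have h : x <= normc (Complex c u + Complex x y).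
  apply: le_trans (Re_le_normc _); rewrite /=.
  by apply: le_trans (ler_norm _); lra.
split; first by rewrite eq_complex /= negb_and; apply/orP; left; rewrite gt_eqF//; lra.
by rewrite normcV lef_pV2 ?posrE//; apply: lt_le_trans h.
Qed.

(* Polynomials in q, V, T, A, B are closed under differentiation, so all derivatives stay bounded. *)
Lemma test_shape_deriv (q V T A B : R -> R -> R[i]) (k ka k1 k2 : R[i]) :
  (forall c u : R, 0 <= c -> cderiv q (fun c u => ka * q c u) c u) ->
  (forall c u : R, 0 <= c ->
     cderiv V (fun c u => k * ((1 + ka * q c u) * (V c u * V c u))) c u) ->
  (forall c u : R, 0 <= c -> cderiv T (fun c u => k * (T c u * T c u)) c u) ->
  (forall c u : R, 0 <= c -> cderiv A (fun c u => k * (A c u * A c u)) c u) ->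
  (forall c u : R, 0 <= c -> cderiv B (fun c u => k * (B c u * B c u)) c u) ->
  hbounded q -> hbounded V -> hbounded T -> hbounded A -> hbounded B ->
  exists f' f'',
    ((forall c u : R, 0 <= c -> cderiv
        (fun c u => (q c u * V c u + (k1 + k2 * T c u)) * (A c u * B c u)) f' c u) /\
     (forall c u : R, 0 <= c -> cderiv f' f'' c u)) /\
    (hbounded f' /\ hbounded (fun c u => q c u * V c u + (k1 + k2 * T c u))).
Proof.
move=> hq hV hT hA hB bq bV bT bA bB.
(* Both derivatives start as unknowns; applying the rules for sums and products fills them in by
   unification. *)
do 2 eexists; split; [split=> c u c0|split].
- apply: cderivM; [apply: cderivD|apply: cderivM].
  + by apply: cderivM; [exact: hq|exact: hV].
  + by apply: cderivD; [exact: cderiv_cst|apply: cderivM; [exact: cderiv_cst|exact: hT]].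
  + exact: hA.
  + exact: hB.
- cbv beta.
  repeat first [apply: (hq _ _ c0)|apply: (hV _ _ c0)|apply: (hT _ _ c0)|apply: (hA _ _ c0)
    |apply: (hB _ _ c0)|apply: cderivD|apply: cderivM|apply: cderiv_cst].
- repeat first [exact: bq|exact: bV|exact: bT|exact: bA|exact: bB
    |apply: hboundedD|apply: hboundedM|apply: hbounded_cst].
- repeat first [exact: bq|exact: bV|exact: bT|exact: bA|exact: bB
    |apply: hboundedD|apply: hboundedM|apply: hbounded_cst].
Qed.

End BoundedHalfPlane.

(** * The symbol s + exp (- a s) and the test function *)

Section DelaySymbol.
Context {R : realType}.
Variable a : R.
Hypotheses (a_ge0 : 0 <= a) (a_lt : a < pi / 2).

(** The characteristic function of the scalar delay equation x'(t) = - x(t - a). *)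
Definition dsym c u : R[i] := Complex c u + expN a c u.

Lemma normc_expN_le1 (c u : R) : 0 <= c -> normc (expN a c u) <= 1.
Proof.
move=> c0; rewrite /expN /= sqrrN !exprMn -mulrDr cos2Dsin2 mulr1.
rewrite sqrtr_sqr ger0_norm ?expR_ge0// expR_le1.
by rewrite oppr_le0 mulr_ge0.
Qed.

(* For |u| <= v the real part is bounded below because a |u| stays away from pi / 2;
   for |u| >= v > 1 the imaginary part is, because |exp (- a s)| <= 1. *)
Lemma dsym_lower_bound : exists2 d : R, 0 < d &
  forall c u : R, 0 <= c -> d <= normc (dsym c u).
Proof.
have p2 := @pihalf_lt2 R; have ag := a_ge0; have al_ := a_lt.
(* [b] is the midpoint of [a] and pi / 2. Since a < pi / 2 < 2, the threshold [v] exceeds 1 by so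
   little that a v <= b, hence cos (a u) >= cos b > 0 for |u| <= v. *)
pose v : R := 1 + (pi / 2 - a) / 4.
pose b : R := (a + pi / 2) / 2.
have v1 : 1 < v by rewrite /v; lra.
have cb : 0 < cos b by apply: cos_gt0_pihalf; rewrite /b; lra.
have av : a * v <= b.
  have : a * (pi / 2 - a) <= 2 * (pi / 2 - a) by apply: ler_wpM2r; lra.
  by rewrite /v /b; nra.
exists (Num.min (v - 1) (Num.min 1 (expR (- a) * cos b))).
  by rewrite !lt_min ltr01 subr_gt0 v1 mulr_gt0// expR_gt0.
move=> c u c0.
have [uv|vu] := leP `|u| v; last first.
  rewrite ge_min; apply/orP; left.
  apply: le_trans (Im_le_normc _); rewrite /dsym /=.
  apply: le_trans (lerB_normD _ _); rewrite normrN.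
  apply: lerB; first exact: ltW.
  rewrite normrM ger0_norm ?expR_ge0//.
  rewrite -[leRHS]mulr1; apply: ler_pM => //; rewrite ?expR_ge0 ?sin_max//.
  by rewrite expR_le1 oppr_le0 mulr_ge0.
rewrite ge_min; apply/orP; right.
apply: le_trans (Re_le_normc _); apply: le_trans (ler_norm _); rewrite /dsym /=.
have cu : cos b <= cos (a * u).
  have aub : `|a * u| <= b.
    by rewrite normrM (ger0_norm a_ge0); apply: le_trans av; apply: ler_wpM2l.
  have pp := @pi_gt0 R.
  have bI : b \in `[0, pi]%R by rewrite in_itv /= /b; apply/andP; split; lra.
  have auI : `|a * u| \in `[0, pi]%R.
    by rewrite in_itv /= normr_ge0 /=; apply: le_trans aub _; rewrite /b; lra.
  by rewrite -(cos_norm (a * u)) leNgt (ltr_cos bI auI) -leNgt.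
(* For c >= 1 the term c alone bounds the real part below by 1; for c < 1 the exponential factor is
   at least exp (- a). *)
have [c1|c1] := leP 1 c.
  rewrite ge_min; apply/orP; left.
  have : 0 <= expR (- (a * c)) * cos (a * u).
    by rewrite mulr_ge0 ?expR_ge0//; lra.
  by lra.
rewrite ge_min; apply/orP; right.
have : expR (- a) * cos b <= expR (- (a * c)) * cos (a * u).
  apply: ler_pM => //; rewrite ?expR_ge0 ?(ltW cb)//.
  by rewrite ler_expR lerN2 ler_piMr// ltW.
by lra.
Qed.

Lemma dsym_neq0 c u : 0 <= c -> dsym c u != 0.
Proof.
move=> c0; have [d d0 /(_ c u c0)] := dsym_lower_bound.
by apply: contraTneq => ->; rewrite normc0 -ltNge.
Qed.

Variables (al e : R).
Hypotheses (e_gt0 : 0 < e).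

(* phi / 2 * d + al * (s * d - 1 / (1 + s)) with d = 1 / (1 + (s + e)^2), rearranged into a
   bounded factor times d. *)
Definition testfun c u : R[i] :=
  (expN a c u * (dsym c u)^-1 + ((- 2^-1 + al * (1 - 2 * e))%:C +
    (- (al * (2 - 2 * e + e ^+ 2)))%:C * (Complex c u + 1)^-1)) *
  ((Complex c u + Complex e (-1))^-1 * (Complex c u + Complex e 1)^-1).

(** The first factor of [testfun] is bounded on the half-plane and the second decays like 1 / |s|^2,
    as [imaginary_axis_integral] requires. The shift by [e] moves the poles to - e + i and - e - i,
    off the closed half-plane. *)
Lemma testfun_integral :
  (\int[@lebesgue_measure R]_u (Re (testfun 0 u))%:E = 0)%E.
Proof.
have eg := e_gt0; have hq := @cderiv_expN R a.
have [d d0 hd] := dsym_lower_bound.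
have [T0 T1] : (forall c u : R, 0 <= c -> Complex c u + 1 != 0) /\
    forall c u : R, 0 <= c -> normc (Complex c u + 1)^-1 <= 1^-1.
  by split=> c u c0; have [] := @affineV_bounded R 1 ltr01 c u c0.
have [A0 A1] : (forall c u : R, 0 <= c -> Complex c u + Complex e (-1) != 0) /\
    forall c u : R, 0 <= c -> normc (Complex c u + Complex e (-1))^-1 <= e^-1.
  by split=> c u c0; have [] := @affineV_bounded R (Complex e (-1)) e_gt0 c u c0.
have [B0 B1] : (forall c u : R, 0 <= c -> Complex c u + Complex e 1 != 0) /\
    forall c u : R, 0 <= c -> normc (Complex c u + Complex e 1)^-1 <= e^-1.
  by split=> c u c0; have [] := @affineV_bounded R (Complex e 1) e_gt0 c u c0.
have hT c u (c0 : 0 <= c) := cderiv_affineV (T0 c u c0).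
have hA c u (c0 : 0 <= c) := cderiv_affineV (A0 c u c0).
have hB c u (c0 : 0 <= c) := cderiv_affineV (B0 c u c0).
have hV c u : 0 <= c -> cderiv (fun c u => (dsym c u)^-1)
   (fun c u => (- 1) * ((1 + Complex (- a) 0 * expN a c u) * ((dsym c u)^-1 * (dsym c u)^-1))) c u.
  move=> c0; have [h1 h2 h3 h4] := cderivV (dsym_neq0 u c0) (cderivD (cderiv_id c u) (hq c u)).
  have E : (- 1) * ((1 + Complex (- a) 0 * expN a c u) * ((dsym c u)^-1 * (dsym c u)^-1)) =
     - (1 + Complex (- a) 0 * expN a c u) * (dsym c u)^-1 * (dsym c u)^-1.
    by rewrite mulN1r !mulNr !mulrA.
  by split; rewrite E.
have bq : hbounded (expN a) by exists 1 => c u c0; exact: normc_expN_le1.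
have bV : hbounded (fun c u => (dsym c u)^-1).
  exists d^-1 => c u c0; rewrite normcV lef_pV2 ?posrE ?hd//.
  by apply: lt_le_trans (hd c u c0).
have bT : hbounded (fun c u : R => (Complex c u + 1)^-1) by exists 1^-1.
have bA : hbounded (fun c u : R => (Complex c u + Complex e (-1))^-1) by exists e^-1.
have bB : hbounded (fun c u : R => (Complex c u + Complex e 1)^-1) by exists e^-1.
have [f' [f'' [[h h'] [[M hM] [K hK]]]]] := @test_shape_deriv R (expN a)
   (fun c u => (dsym c u)^-1) (fun c u => (Complex c u + 1)^-1)
   (fun c u => (Complex c u + Complex e (-1))^-1) (fun c u => (Complex c u + Complex e 1)^-1)
   (- 1) (Complex (- a) 0) ((- 2^-1 + al * (1 - 2 * e))%:C) ((- (al * (2 - 2 * e + e ^+ 2)))%:C)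
   (fun c u _ => hq c u) hV hT hA hB bq bV bT bA bB.
have K0 : 0 <= K by apply: le_trans (hK 0 0 (lexx _)); exact: normc_ge0.
(* The summand 2 comes from u^2 <= 2 (u + y)^2 + 2, where y is 1 or - 1; the remaining constant 3 =
   1 + 2 is absorbed by (c + e)^2 >= e^2. *)
pose k : R := 3 / e ^+ 2 + 2.
have k0 : 0 < k.
  have e3 : 0 < 3 / e ^+ 2 by rewrite divr_gt0// exprn_gt0.
  by rewrite /k; lra.
have dec (y c u : R) : y ^+ 2 = 1 -> 0 <= c ->
    1 + c ^+ 2 + u ^+ 2 <= k * normc (Complex c u + Complex e y) ^+ 2.
  move=> y1 c0.
  have -> : normc (Complex c u + Complex e y) ^+ 2 = (c + e) ^+ 2 + (u + y) ^+ 2.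
    by rewrite sqr_sqrtr// addr_ge0 ?sqr_ge0.
  have h1 : 3 <= 3 / e ^+ 2 * (c + e) ^+ 2.
    rewrite -mulrA ler_peMr// mulrC ler_pdivlMr ?exprn_gt0// mul1r.
    by rewrite lerXn2r ?nnegrE; lra.
  have h2 : 0 <= 3 / e ^+ 2 * (u + y) ^+ 2.
    by rewrite mulr_ge0 ?sqr_ge0// divr_ge0// ?exprn_ge0// ltW.
  have h3 : c ^+ 2 <= (c + e) ^+ 2 by rewrite lerXn2r ?nnegrE//; lra.
  have h4 : u ^+ 2 <= 2 * (u + y) ^+ 2 + 2.
    by have := sqr_ge0 (u + 2 * y); nra.
  by rewrite /k mulrDl !mulrDr; have := sqr_ge0 (c + e); lra.
apply: (@imaginary_axis_integral R testfun f' f'' h _ (K * k) M).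
- by move=> c u c0; apply: h'; exact: ltW.
- by move=> c u c0; apply: hM; exact: ltW.
move=> c u /ltW c0; rewrite /testfun normcM -mulrA.
apply: ler_pM; [exact: normc_ge0..|exact: hK|].
rewrite normcM !normcV -invfM.
set x := normc _; set y := normc _.
set w := 1 + _ + _.
have w0 : 0 < w by rewrite /w; have := sqr_ge0 c; have := sqr_ge0 u; lra.
have hx : w <= k * x ^+ 2 by apply: dec; rewrite ?sqrrN ?expr1n.
have hy : w <= k * y ^+ 2 by apply: dec; rewrite ?expr1n.
have x0 : 0 < x by rewrite lt_def normc_ge0 andbT; apply/eqP => x0; move: hx; rewrite x0; lra.
have y0 : 0 < y by rewrite lt_def normc_ge0 andbT; apply/eqP => y0; move: hy; rewrite y0; lra.
rewrite ler_pdivlMr// mulrC ler_pdivrMr ?mulr_gt0//.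
have kxy : 0 <= k * (x * y) by rewrite ltW ?mulr_gt0.
(* The bound w <= k x y is the geometric mean of w <= k x^2 and w <= k y^2, obtained by comparing
   squares. *)
rewrite -(@ler_pXn2r _ 2) ?nnegrE ?(ltW w0)//.
rewrite [leRHS](_ : _ = (k * x ^+ 2) * (k * y ^+ 2)); last by ring.
by rewrite expr2; apply: ler_pM => //; exact: ltW.
Qed.

End DelaySymbol.

(** * The integral of 1 / |i u + exp (- i a u)|^2 *)

Section DelayIntegral.
Context {R : realType}.
Notation mu := (@lebesgue_measure R).

Lemma sin_lip (x y : R) : `|sin x - sin y| <= `|x - y|.
Proof.
wlog xy : x y / y <= x => [h|].
  have [/h//|/ltW/h] := leP y x.
  by rewrite distrC => /le_trans; apply; rewrite distrC.
have [z _ ->] := @MVT_segment R sin cos y x xy (fun z _ => is_derive_sin z)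
   (continuous_subspaceT (@continuous_sin R)).
by rewrite normrM ler_piMl// cos_max.
Qed.

Lemma cos_lip (x y : R) : `|cos x - cos y| <= `|x - y|.
Proof.
have := sin_lip (x + pi / 2) (y + pi / 2); rewrite !sinDpihalf.
by rewrite opprD addrACA subrr addr0.
Qed.

Variable a : R.
Hypotheses (a_ge0 : 0 <= a) (a_lt : a < pi / 2).

Definition ddenom (u : R) : R := 1 + u ^+ 2 - 2 * u * sin (a * u).

Lemma ddenomE u : ddenom u = cos (a * u) ^+ 2 + (u - sin (a * u)) ^+ 2.
Proof. by rewrite /ddenom cos2sin2; ring. Qed.

Lemma sqr_normc_dsym u : ddenom u = normc (dsym a 0 u) ^+ 2.
Proof.
rewrite ddenomE /dsym /expN /= mulr0 oppr0 expR0 !mul1r add0r.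
by rewrite sqr_sqrtr// addr_ge0 ?sqr_ge0.
Qed.

(** For |u| <= 3 the lower bound on [dsym] suffices, as 1 + u^2 <= 10 there; beyond 3 the quadratic
    term wins, since 1 + u^2 - 2 |u| >= (1 + u^2) / 4. *)
Lemma ddenom_lower_bound : exists2 k : R, 0 < k & forall u, k * oneDsqr u <= ddenom u.
Proof.
have [d d0 hd] := dsym_lower_bound a_ge0 a_lt.
have d2 : 0 < d ^+ 2 by rewrite exprn_gt0.
exists (Num.min (1 / 4) (d ^+ 2 / 10)); first by rewrite lt_min; apply/andP; split; lra.
move=> u; have o1 := oneDsqr_ge1 u.
have [u3|u3] := leP `|u| 3.
  have h : d ^+ 2 <= ddenom u.
    rewrite sqr_normc_dsym; have := hd 0 u (lexx _) => h.
    by rewrite lerXn2r ?nnegrE//; [exact: ltW|exact: normc_ge0].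
  apply: le_trans h.
  have : Num.min (1 / 4) (d ^+ 2 / 10) <= d ^+ 2 / 10 by rewrite ge_min lexx orbT.
  have u9 : oneDsqr u <= 10.
    have : u ^+ 2 <= 3 ^+ 2 by rewrite -(real_normK (num_real u)) lerXn2r ?nnegrE.
    by rewrite /oneDsqr; lra.
  set m := Num.min _ _ => mle.
  apply: (@le_trans _ _ (d ^+ 2 / 10 * oneDsqr u)); first by apply: ler_wpM2r => //; lra.
  by rewrite -[leRHS](@divfK _ 10)// ler_wpM2l//; lra.
have : Num.min (1 / 4) (d ^+ 2 / 10) <= 1 / 4 by rewrite ge_min lexx.
set m := Num.min _ _ => mle.
apply: (@le_trans _ _ (1 / 4 * oneDsqr u)); first by apply: ler_wpM2r => //; lra.
have h : u * sin (a * u) <= `|u|.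
  apply: le_trans (ler_norm _) _; rewrite normrM ler_piMr// sin_max//.
rewrite /ddenom /oneDsqr -(real_normK (num_real u)).
by nra.
Qed.

Lemma ddenom_gt0 u : 0 < ddenom u.
Proof.
have [k k0 /(_ u)] := ddenom_lower_bound; apply: lt_le_trans.
by rewrite mulr_gt0// (lt_le_trans _ (oneDsqr_ge1 u)).
Qed.

Lemma continuous_ddenom : continuous ddenom.
Proof.
move=> u; rewrite /ddenom; apply: cvgB.
  by apply: continuous_oneDsqr.
apply: cvgM; first by apply: cvgM; [exact: cvg_cst|exact: cvg_id].
apply: (@continuous_comp _ _ _ (fun u => a * u) sin); last exact: continuous_sin.
by apply: cvgM; [exact: cvg_cst|exact: cvg_id].
Qed.

Let al : R := cos a / (2 * (1 - sin a)).

Let sin_lt1 : 0 < 1 - sin a.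
Proof.
have ag := a_ge0; have al_ := a_lt; have p0 := @pi_gt0 R.
rewrite subr_gt0 -(@sin_pihalf R) ltr_sin ?in_itv/=; [exact: a_lt|lra..].
Qed.

Let cos_gt0 : 0 < cos a.
Proof.
by have ag := a_ge0; have al_ := a_lt; have p0 := @pi_gt0 R; apply: cos_gt0_pihalf; lra.
Qed.

Let al_gt0 : 0 < al.
Proof. by rewrite /al divr_gt0// mulr_gt0. Qed.

(* al is chosen so that the left-hand side vanishes at u = 1 and u = -1. *)
Lemma al_cancel : exists2 k : R, 0 <= k &
  forall u, `|al * ddenom u - cos (a * u)| <= k * `|u ^+ 2 - 1|.
Proof.
have al0 := al_gt0; have a0 := a_ge0; have s1 := sin_lt1.
exists (al + 2 * al * (1 + a) + a); first nra.
move=> u; wlog u0 : u / 0 <= u => [h|].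
  have [/h//|/ltW u0] := leP 0 u.
  have := h (- u); rewrite oppr_ge0 => /(_ u0).
  have -> : ddenom (- u) = ddenom u by rewrite /ddenom (mulrN a) sinN; ring.
  by rewrite sqrrN (mulrN a) cosN.
have h1 : al * ddenom 1 = cos a.
  by rewrite /ddenom mulr1 expr1n mulr1 /al; field; rewrite ?gt_eqF//; lra.
(* Subtracting the identity at u = 1 leaves a multiple of u^2 - 1 and terms that are O(|u - 1|) by
   the Lipschitz bounds; for u >= 0 the latter are absorbed through |u - 1| <= |u^2 - 1|. *)
have e1 : al * ddenom u - cos (a * u) = al * (u ^+ 2 - 1)
   - 2 * al * ((u - 1) * sin (a * u) + (sin (a * u) - sin a)) - (cos (a * u) - cos a).
  rewrite -h1 /ddenom (mulr1 a); ring.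
have au : `|a * u - a| = a * `|u - 1|.
  by rewrite -{2}(mulr1 a) -mulrBr normrM (ger0_norm a_ge0).
have hs : `|sin (a * u) - sin a| <= a * `|u - 1| by rewrite -au sin_lip.
have hc : `|cos (a * u) - cos a| <= a * `|u - 1| by rewrite -au cos_lip.
have hu : `|(u - 1) * sin (a * u)| <= `|u - 1| by rewrite normrM ler_piMr// sin_max.
have hm : `|u - 1| <= `|u ^+ 2 - 1|.
  have -> : u ^+ 2 - 1 = (u - 1) * (u + 1) by ring.
  by rewrite normrM ler_peMr// ger0_norm; lra.
rewrite e1; apply: le_trans (ler_normB _ _) _.
apply: le_trans (lerD (ler_normB _ _) hc) _.
have al2 : 0 < 2 * al by lra.
rewrite (normrM al) (normrM (2 * al)) (gtr0_norm al0) (gtr0_norm al2).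
have hsum : `|(u - 1) * sin (a * u) + (sin (a * u) - sin a)| <= (1 + a) * `|u ^+ 2 - 1|.
  apply: le_trans (ler_normD _ _) _; apply: le_trans (lerD hu hs) _.
  have : a * `|u - 1| <= a * `|u ^+ 2 - 1| by apply: ler_wpM2l.
  lra.
have h2 : 2 * al * `|(u - 1) * sin (a * u) + (sin (a * u) - sin a)| <=
    2 * al * ((1 + a) * `|u ^+ 2 - 1|) by apply: ler_wpM2l => //; lra.
have h3 : a * `|u - 1| <= a * `|u ^+ 2 - 1| by apply: ler_wpM2l.
by move: h2; lra.
Qed.

(** The squared modulus of 1 + (s + e)^2 at s = i u. *)
Let E (e u : R) : R := (1 + e ^+ 2 - u ^+ 2) ^+ 2 + (2 * e * u) ^+ 2.

(* The difference between Re (testfun a al e 0 u) and its limit as e tends to 0. *)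
Let rem (e u : R) : R :=
  e * (2 * u ^+ 2 * (al * ddenom u - cos (a * u)) - e * (1 + e ^+ 2 + 3 * u ^+ 2) / 2)
  / (ddenom u * E e u).

Let E_fact e u : E e u = ((u - 1) ^+ 2 + e ^+ 2) * ((u + 1) ^+ 2 + e ^+ 2).
Proof. by rewrite /E; ring. Qed.

Let E_gt0 e u : 0 < e -> 0 < E e u.
Proof.
move=> e0; rewrite E_fact.
by rewrite mulr_gt0// ltr_wpDl ?sqr_ge0// exprn_gt0.
Qed.

(** Once cos^2 is replaced by 1 - sin^2, this is an identity of rational functions in u, e, the sine
    and the cosine. *)
Lemma Re_testfun_axis e u : 0 < e ->
  Re (testfun a al e 0 u) = rem e u + 2^-1 * (ddenom u)^-1 - al * (oneDsqr u)^-1.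
Proof.
move=> e0; have D0 := ddenom_gt0 u; have E0 := E_gt0 u e0.
have O0 : 0 < oneDsqr u by apply: lt_le_trans (oneDsqr_ge1 u).
rewrite /rem.
move: (D0) (E0) (O0); rewrite /E /ddenom /oneDsqr.
rewrite /testfun /dsym /expN /= mulr0 oppr0 expR0 !mul1r !add0r.
have := cos2Dsin2 (a * u); set C := cos _; set S := sin _ => CS {}D0 {}E0 {}O0.
have C2 : C ^+ 2 = 1 - S ^+ 2 by rewrite -CS; ring.
have -> : C ^+ 2 + (u - S) ^+ 2 = 1 + u ^+ 2 - 2 * u * S by rewrite C2; ring.
move: D0 E0 O0; set D := (X in 0 < X -> _); move=> D0 E0 O0.
have -> : C * (C / D) - - S * - ((u - S) / D) = (1 - u * S) / D.
  have -> : C * (C / D) = C ^+ 2 / D by rewrite mulrA.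
  by rewrite C2; field; rewrite gt_eqF.
have -> : C * - ((u - S) / D) + - S * (C / D) = - (C * u) / D.
  by field; rewrite gt_eqF.
have -> : u + 0 = u by rewrite addr0.
have e1 : e ^+ 2 + (u - 1) ^+ 2 != 0 by rewrite gt_eqF// ltr_wpDr ?sqr_ge0// exprn_gt0.
have e2 : e ^+ 2 + (u + 1) ^+ 2 != 0 by rewrite gt_eqF// ltr_wpDr ?sqr_ge0// exprn_gt0.
(* The identity holds for every coefficient, so [al] is made opaque for [field]. *)
generalize al => b; rewrite /D in D0 *.
field; rewrite ?e1 ?e2 ?(gt_eqF O0) ?(gt_eqF D0) ?(gt_eqF E0) ?expr1n ?(gt_eqF O0)//.
Qed.

(** This bound is uniform in [e] but degenerates at u = 1 and u = - 1, where [E_ge2] takes over at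
    the price of a factor e^2. *)
Let E_ge1 e u : (u ^+ 2 - 1) ^+ 2 <= E e u.
Proof.
have -> : (u ^+ 2 - 1) ^+ 2 = (u - 1) ^+ 2 * (u + 1) ^+ 2 by ring.
by rewrite E_fact; apply: ler_pM; rewrite ?sqr_ge0// lerDl sqr_ge0.
Qed.

Let E_ge2 e u : e ^+ 2 * (1 + u ^+ 2 + e ^+ 2) <= E e u.
Proof.
have h : 0 <= (u ^+ 2 - 1) ^+ 2 + e ^+ 2 * (u ^+ 2 + 1).
  by rewrite addr_ge0 ?sqr_ge0// mulr_ge0 ?sqr_ge0// addr_ge0 ?sqr_ge0.
by move: h; rewrite /E; nra.
Qed.

(** Supplies the dominating function for [e] tending to 0. By [al_cancel] the numerator is O(e^2) at
    u = 1 and u = - 1, which makes up for the smallness of [E] there; 8 k and 3 / 2 bound its two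
    parts relative to [E]. *)
Lemma rem_dominated : exists K : R,
  forall e u, 0 < e -> e <= 1 -> `|rem e u| <= K * (oneDsqr u)^-1.
Proof.
have [k k0 hk] := al_cancel; have [d d0 hd] := ddenom_lower_bound.
exists ((8 * k + 3 / 2) / d) => e u e0 e1.
have D0 := ddenom_gt0 u; have E0 := E_gt0 u e0; have O1 := oneDsqr_ge1 u.
have h1 := E_ge1 e u; have h2 := E_ge2 e u.
set x := al * ddenom u - cos (a * u).
have hx : `|x| <= k * `|u ^+ 2 - 1| by exact: hk.
have n2 : e * (1 + e ^+ 2 + 3 * u ^+ 2) / 2 * e <= 3 / 2 * E e u.
  have : 0 <= e ^+ 2 * (2 + 2 * e ^+ 2).
    by rewrite mulr_ge0 ?sqr_ge0//; have := sqr_ge0 e; lra.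
  by move: h2; nra.
have n1 : e * (2 * u ^+ 2 * `|u ^+ 2 - 1|) <= 8 * E e u.
  set y := `|u ^+ 2 - 1| in hx *.
  have y0 : 0 <= y by exact: normr_ge0.
  have h1' : y ^+ 2 <= E e u by rewrite /y real_normK ?num_real.
  have u0 := sqr_ge0 u.
  (* For u^2 <= 4, e^2 <= E and y^2 <= E give e y <= E. For u^2 > 4, e <= 1 and u^2 <= 4 (u^2 - 1)
     give the bound 8 y^2. *)
  have [u2|u2] := leP (u ^+ 2) 4.
    have : e * y <= E e u.
      have : e ^+ 2 <= E e u.
        apply: le_trans h2; rewrite ler_peMr ?sqr_ge0//; have := sqr_ge0 e; lra.
      by have := sqr_ge0 (e - y); nra.
    move=> ey; apply: (@le_trans _ _ (8 * (e * y))); last lra.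
    have : 0 <= e * y by rewrite mulr_ge0// ltW.
    by nra.
  have yE : y = u ^+ 2 - 1 by rewrite /y ger0_norm//; lra.
  apply: (@le_trans _ _ (8 * y ^+ 2)); last lra.
  have : e * (2 * u ^+ 2 * y) <= 2 * u ^+ 2 * y.
    by apply: ler_piMl => //; apply: mulr_ge0 => //; apply: mulr_ge0.
  by rewrite yE; nra.
rewrite /rem normrM normfV (gtr0_norm (mulr_gt0 D0 E0)) -/x.
rewrite normrM (gtr0_norm e0).
have n3 : e * `|2 * u ^+ 2 * x - e * (1 + e ^+ 2 + 3 * u ^+ 2) / 2| <=
    (8 * k + 3 / 2) * E e u.
  have b0 : 0 <= e * (1 + e ^+ 2 + 3 * u ^+ 2) / 2.
    by have := sqr_ge0 u; have := sqr_ge0 e => ? ?; rewrite divr_ge0// mulr_ge0 ?ltW//; lra.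
  have nb : `|2 * u ^+ 2 * x - e * (1 + e ^+ 2 + 3 * u ^+ 2) / 2| <=
     2 * u ^+ 2 * `|x| + e * (1 + e ^+ 2 + 3 * u ^+ 2) / 2.
    apply: le_trans (ler_normB _ _) _.
    rewrite (ger0_norm b0) lerD2r normrM ger0_norm// mulr_ge0// sqr_ge0//.
  apply: le_trans (ler_wpM2l (ltW e0) nb) _.
  have : e * (2 * u ^+ 2 * `|x|) <= k * (8 * E e u).
    apply: (@le_trans _ _ (k * (e * (2 * u ^+ 2 * `|u ^+ 2 - 1|)))); last exact: ler_wpM2l.
    rewrite [leRHS](_ : _ = e * (2 * u ^+ 2 * (k * `|u ^+ 2 - 1|))); last by ring.
    apply: ler_wpM2l; first exact: ltW.
    by apply: ler_wpM2l => //; rewrite mulr_ge0// sqr_ge0.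
  by move: n2; rewrite mulrDr; nra.
rewrite ler_pdivrMr ?mulr_gt0//.
apply: le_trans n3 _.
rewrite -(mulrA _ (oneDsqr u)^-1) [leRHS](_ : _ = (8 * k + 3 / 2) * (d^-1 * (oneDsqr u)^-1 * ddenom u * E e u)); last by ring.
apply: ler_wpM2l; first lra.
rewrite -{1}[E e u]mul1r; apply: ler_wpM2r; first exact: ltW.
rewrite -invfM mulrC ler_pdivlMr ?mul1r//.
by rewrite mulr_gt0// (lt_le_trans _ O1).
Qed.

(** Here [E] stays above (u^2 - 1)^2 > 0 for every [e], so the factor [e] in the numerator yields a
    bound W e. *)
Lemma rem_cvg0 u : u ^+ 2 != 1 -> rem n.+1%:R^-1 u @[n --> \oo] --> (0 : R).
Proof.
move=> u1; have D0 := ddenom_gt0 u.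
have y0 : 0 < (u ^+ 2 - 1) ^+ 2 by rewrite exprn_even_gt0//= subr_eq0.
pose W : R := (`|2 * u ^+ 2 * (al * ddenom u - cos (a * u))| + (2 + 3 * u ^+ 2) / 2)
   / (ddenom u * (u ^+ 2 - 1) ^+ 2).
have hW (e : R) : 0 < e -> e <= 1 -> `|rem e u| <= W * e.
  move=> e0 e1; rewrite /rem /W.
  have E0 := E_gt0 u e0.
  rewrite normrM normfV (gtr0_norm (mulr_gt0 D0 E0)) normrM (gtr0_norm e0).
  rewrite -mulrA mulrC; apply: ler_wpM2r; first exact: ltW.
  apply: ler_pM => //.
  - by rewrite invr_ge0 mulr_ge0// ltW.
  - apply: le_trans (ler_normB _ _) _; rewrite lerD2l.
    have u0 := sqr_ge0 u.
    have e2 : e ^+ 2 <= 1 by rewrite expr_le1// ltW.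
    have e3 := sqr_ge0 e.
    rewrite ger0_norm; last by rewrite divr_ge0// mulr_ge0 ?ltW//; lra.
    apply: ler_wpM2r; first by rewrite invr_ge0.
    by apply: le_trans (ler_piMl _ e1) _; lra.
  - have h1 := mulr_gt0 D0 E0; have h2 := mulr_gt0 D0 y0.
    by rewrite lef_pV2 ?posrE// ler_pM2l//; exact: E_ge1.
apply/cvgr0Pnorm_le => e e0.
have cW : W * n.+1%:R^-1 @[n --> \oo] --> (0 : R).
  rewrite -[X in _ --> X](mulr0 W); apply: cvgM; first exact: cvg_cst.
  exact: cvg_harmonic.
move/cvgr0Pnorm_le : cW => /(_ e e0) [m _ hm]; exists m => // n mn /=.
apply: le_trans (hW _ _ _) _; rewrite ?invr_gt0 ?ltr0n// ?invf_le1 ?ltr0n ?ler1n//.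
by apply: le_trans (ler_norm _) _; exact: hm.
Qed.

Let continuous_rem e : 0 < e -> continuous (rem e).
Proof.
move=> e0 u; rewrite /rem.
have cD := continuous_ddenom.
have csq : continuous (fun u : R => u ^+ 2) by move=> x; exact: exprn_continuous.
have cC : continuous (fun u => cos (a * u)).
  move=> x; apply: (@continuous_comp _ _ _ (fun u => a * u) cos); last exact: continuous_cos.
  by apply: cvgM; [exact: cvg_cst|exact: cvg_id].
apply: cvgM.
  apply: cvgM; first exact: cvg_cst.
  apply: cvgB.
    apply: cvgM; first by apply: cvgM; [exact: cvg_cst|exact: csq].
    apply: cvgB; last exact: cC.
    by apply: cvgM; [exact: cvg_cst|exact: cD].
  apply: cvgM; last exact: cvg_cst.
  apply: cvgM; first exact: cvg_cst.
  apply: cvgD; first exact: cvg_cst.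
  by apply: cvgM; [exact: cvg_cst|exact: csq].
apply: cvgV; first by rewrite gt_eqF// mulr_gt0// ?ddenom_gt0// E_gt0.
apply: cvgM; first exact: cD.
have cM : continuous (fun u : R => 2 * e * u).
  by move=> x; apply: cvgM; [exact: cvg_cst|exact: cvg_id].
have cS : continuous (fun u : R => 1 + e ^+ 2 - u ^+ 2).
  by move=> x; apply: cvgB; [exact: cvg_cst|exact: csq].
apply: cvgD.
  exact: (@continuous_comp _ _ _ (fun u : R => 1 + e ^+ 2 - u ^+ 2) (fun x => x ^+ 2) _
    (cS u) (csq _)).
exact: (@continuous_comp _ _ _ (fun u : R => 2 * e * u) (fun x => x ^+ 2) _ (cM u) (csq _)).
Qed.

Let continuous_ddenomV : continuous (fun u => (ddenom u)^-1).
Proof.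
by move=> u; apply: cvgV; [rewrite gt_eqF// ddenom_gt0|exact: continuous_ddenom].
Qed.

Let integrable_ddenomV : mu.-integrable setT (EFin \o (fun u => (ddenom u)^-1)).
Proof.
have [k k0 hk] := ddenom_lower_bound.
apply: (@dominated_integrable R _ k^-1).
  exact: continuous_measurable_fun.
move=> u; have D0 := ddenom_gt0 u; have O1 := oneDsqr_ge1 u.
rewrite gtr0_norm ?invr_gt0// -invfM lef_pV2 ?posrE//.
by rewrite mulr_gt0// (lt_le_trans _ O1).
Qed.

(** Integrates [Re_testfun_axis], whose left-hand side has integral 0. The point is that the value
    does not depend on [e]. *)
Let Rintegral_rem e : 0 < e -> e <= 1 ->
  \int[mu]_u rem e u = al * pi - 2^-1 * \int[mu]_u (ddenom u)^-1.
Proof.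
move=> e0 e1.
have [K hK] := rem_dominated.
have ir : mu.-integrable setT (EFin \o rem e).
  apply: (@dominated_integrable R _ K); last by move=> u; exact: hK.
  by apply: continuous_measurable_fun; exact: continuous_rem.
have iD2 : mu.-integrable setT (EFin \o (fun u => 2^-1 * (ddenom u)^-1)).
  rewrite (_ : _ \o _ = (fun u => (2^-1)%:E * ((ddenom u)^-1)%:E)%E); first exact: integrableZl.
  by apply/funext => u; rewrite -EFinM.
have iO := integrable_oneDsqrV (R := R) al.
have iO1 : mu.-integrable setT (EFin \o (fun u : R => (oneDsqr u)^-1)).
  have := integrable_oneDsqrV (R := R) 1.
  by under eq_fun do rewrite mul1r.
have irD : mu.-integrable setT (EFin \o (fun u => rem e u + 2^-1 * (ddenom u)^-1)).
  rewrite (_ : _ \o _ = ((EFin \o rem e) \+ (EFin \o (fun u => 2^-1 * (ddenom u)^-1)%R))%E).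
    exact: integrableD.
  by apply/funext => u; rewrite /= -EFinD.
have : \int[mu]_u Re (testfun a al e 0 u) = 0.
  by rewrite /Rintegral (testfun_integral a_ge0 a_lt al e0).
under eq_Rintegral do rewrite Re_testfun_axis//.
rewrite RintegralB// RintegralD// !RintegralZl//.
have -> : \int[mu]_u (oneDsqr u)^-1 = pi :> R by rewrite /Rintegral integralT_oneDsqrV.
by lra.
Qed.

(** The integrals of [rem] form a constant sequence that tends to 0 by dominated convergence; the
    vanishing of the constant gives the integral as 2 al pi. *)
Lemma integral_ddenomV :
  (\int[mu]_u ((ddenom u)^-1)%:E = (pi * (cos a / (1 - sin a)))%:E)%E.
Proof.
have [K hK] := rem_dominated.
pose e (n : nat) : R := n.+1%:R^-1.
have e0 n : 0 < e n by rewrite invr_gt0 ltr0n.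
have e1 n : e n <= 1 by rewrite invf_le1 ?ltr0n// ler1n.
have me n : measurable_fun setT (EFin \o rem (e n)).
  apply/measurable_EFinP; apply: continuous_measurable_fun; exact: continuous_rem.
have c0 : {ae mu, forall u, [set: R] u -> (EFin \o rem (e n)) u @[n --> \oo] --> (cst 0 u : \bar R)}.
  have : mu ([set 1] `|` [set (-1)]) = 0%E.
    apply/eqP; rewrite eq_le measure_ge0 andbT.
    apply: le_trans (measureU2 _ _ _) _ => //.
    by rewrite /= !lebesgue_measure_set1 adde0.
  (* The points 1 and - 1, where [rem] does not tend to 0, form a null set. *)
  move=> h; exists ([set 1] `|` [set (-1)]); split => //.
    exact: measurableU.
  move=> u /=; apply: contra_notP => /not_orP[u1 u2] _.
  apply: cvg_EFin; first by near=> n.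
  apply: rem_cvg0; rewrite -subr_eq0 subr_sqr_1 mulf_neq0// ?subr_eq0 ?addr_eq0; exact/eqP.
have dom : {ae mu, forall u n, [set: R] u ->
    (`|(EFin \o rem (e n)) u| <= (K * (oneDsqr u)^-1)%:E)%E}.
  by apply: aeW => u n _; rewrite lee_fin; exact: hK.
have [_ _ cv] := @dominated_convergence _ _ _ mu setT measurableT _ (cst 0%E) _
  me (measurable_cst _) c0 (integrable_oneDsqrV K) dom.
have c1 : (\int[mu]_u (EFin \o rem (e n)) u)%E @[n --> \oo] -->
    (al * pi - 2^-1 * \int[mu]_u (ddenom u)^-1)%:E.
  have En n : (\int[mu]_u (EFin \o rem (e n)) u)%E =
      (al * pi - 2^-1 * \int[mu]_u (ddenom u)^-1)%:E.
    rewrite -(Rintegral_rem (e0 n) (e1 n)) /Rintegral fineK//.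
    apply: integrable_fin_num => //.
    apply: (@dominated_integrable R _ K); last by move=> u; exact: hK.
    by apply: continuous_measurable_fun; exact: continuous_rem.
  by under eq_fun do rewrite En; exact: cvg_cst.
have : (al * pi - 2^-1 * \int[mu]_u (ddenom u)^-1)%:E = (\int[mu]_u (cst 0%E u))%E.
  by apply: cvg_unique c1 cv.
rewrite integral0 => -[h].
have -> : (\int[mu]_u ((ddenom u)^-1)%:E)%E = (\int[mu]_u (ddenom u)^-1)%:E.
  by rewrite /Rintegral fineK//; exact: integrable_fin_num.
congr EFin; have s1 := sin_lt1.
have -> : \int[mu]_u (ddenom u)^-1 = 2 * al * pi by lra.
by rewrite /al; field; rewrite gt_eqF.
Unshelve. all: end_near. Qed.

End DelayIntegral.

(** * The frequency integral of one mode, by scaling *)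

Section ModeIntegral.
Context {R : realType}.
Notation mu := (@lebesgue_measure R).

(* [mode_sq tau l w] is |i w + l exp(- i tau w)|^2. *)
Definition mode_sq (tau l w : R) : R := w ^+ 2 - 2 * l * w * sin (tau * w) + l ^+ 2.

Lemma mode_sqZ (tau l u : R) : mode_sq tau l (l * u) = l ^+ 2 * ddenom (tau * l) u.
Proof. by rewrite /mode_sq /ddenom (mulrA tau); ring. Qed.

Lemma mode_sq_gt0 (tau l w : R) : 0 <= tau -> 0 < l -> tau * l < pi / 2 ->
  0 < mode_sq tau l w.
Proof.
move=> t0 l0 tl; have := mode_sqZ tau l (l^-1 * w).
rewrite mulrA divff ?gt_eqF// mul1r => ->.
by rewrite mulr_gt0 ?exprn_gt0// ddenom_gt0// mulr_ge0// ltW.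
Qed.

Lemma continuous_mode_sqV (tau l : R) : 0 <= tau -> 0 < l -> tau * l < pi / 2 ->
  continuous (fun w => (mode_sq tau l w)^-1).
Proof.
move=> t0 l0 tl w; apply: cvgV; first by rewrite gt_eqF// mode_sq_gt0.
rewrite /mode_sq; apply: cvgD; last exact: cvg_cst.
apply: cvgB; first exact: exprn_continuous.
apply: cvgM; first by apply: cvgM; [exact: cvg_cst|exact: cvg_id].
apply: (@continuous_comp _ _ _ (fun u => tau * u) sin); last exact: continuous_sin.
by apply: cvgM; [exact: cvg_cst|exact: cvg_id].
Qed.

(** The substitution w = l u reduces to eigenvalue 1 with delay tau l; the factor l^-2 from
    [mode_sqZ] and the Jacobian l leave l^-1. *)
Lemma integral_mode_sqV (tau l : R) : 0 <= tau -> 0 < l -> tau * l < pi / 2 ->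
  (\int[mu]_w ((mode_sq tau l w)^-1)%:E =
   (pi * (l^-1 * (cos (tau * l) / (1 - sin (tau * l)))))%:E)%E.
Proof.
move=> t0 l0 tl; have tl0 : 0 <= tau * l by rewrite mulr_ge0// ltW.
have dl (x : R) : is_derive x 1 (fun x => l * x) l.
  by apply: (is_derive_eq (is_deriveZ l (is_derive_id x 1))); rewrite /GRing.scale /= mulr1.
have Fd : (fun x : R => l * x)^`() = cst l.
  by apply/funext => x; rewrite derive1E; have [_ ->] := dl x.
rewrite (@increasing_ge0_integration_by_substitutionT R (fun x => l * x)
  (fun w => (mode_sq tau l w)^-1)).
- rewrite Fd.
  have -> : (fun x => ((((fun w => (mode_sq tau l w)^-1) \o (fun x => l * x)) * cst l) x)%:E) =
      (fun x => (l^-1)%:E * ((ddenom (tau * l) x)^-1)%:E)%E.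
    apply/funext => x; rewrite -EFinM; congr EFin.
    rewrite /= [LHS](_ : _ = (mode_sq tau l (l * x))^-1 * l)// mode_sqZ.
    by have D0 := ddenom_gt0 tl0 tl x; field; rewrite !gt_eqF.
  rewrite ge0_integralZl//.
  + by rewrite integral_ddenomV// -EFinM; congr EFin; ring.
  + apply/measurable_EFinP; apply: continuous_measurable_fun => x.
    by apply: cvgV; [rewrite gt_eqF// ddenom_gt0|exact: continuous_ddenom].
  + by move=> x _; rewrite lee_fin invr_ge0 ltW// ddenom_gt0.
  + by rewrite lee_fin invr_ge0 ltW.
- by move=> x y xy; rewrite ltr_pM2l.
- by rewrite Fd; exact: cst_continuous.
- by rewrite Fd; exact: is_cvg_cst.
- by rewrite Fd; exact: is_cvg_cst.
- by move=> x; have [] := dl x.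
- by apply: gt0_cvgMrNy => //; exact: cvg_id.
- by apply: gt0_cvgMry => //; exact: cvg_id.
- exact: continuous_mode_sqV.
- by move=> x; rewrite invr_ge0 ltW// mode_sq_gt0.
Qed.

End ModeIntegral.
(** * Spectral resolution *)

Section LagrangeResolution.
Variables F K : fieldType.
Variable f : {rmorphism F -> K}.

Lemma trmx_horner_mx n (L : 'M[F]_n.+1) (p : {poly F}) : L^T = L ->
  (horner_mx L p)^T = horner_mx L p.
Proof.
move=> Ls; elim/poly_ind: p => [|p c IH]; first by rewrite rmorph0 trmx0.
rewrite rmorphD rmorphM /= horner_mx_C horner_mx_X linearD /= tr_scalar_mx.
rewrite trmx_mul Ls IH; congr (_ + _).
by apply: comm_mx_horner.
Qed.

Definition lagrange (rs : seq F) (r : F) : {poly F} :=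
  \prod_(s <- rs | s != r) ((r - s)^-1 *: ('X - s%:P)).

Lemma lagrangeE rs r s : s \in rs -> (lagrange rs r).[s] = (s == r)%:R.
Proof.
move=> srs; rewrite /lagrange horner_prod.
have [->|sr] := eqVneq s r.
  rewrite big1// => t tr; rewrite !hornerE mulVf// subr_eq0 eq_sym//.
by rewrite (big_rem s)//= sr !hornerE subrr mulr0 mul0r.
Qed.

Notation toK := (map_mx f).

(* The projections are Lagrange polynomials in L, hence have entries in F
   although L is only assumed to be diagonalised over K. *)
Lemma lagrange_resolution n (L : 'M[F]_n.+1) (U : 'M[K]_n.+1) (d : 'rV[F]_n.+1) :
  L^T = L -> U \in unitmx -> toK L = invmx U *m diag_mx (toK d) *m U ->
  exists (k : nat) (lam : 'I_k -> F) (P : 'I_k -> 'M[F]_n.+1),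
    [/\ \sum_i P i = 1%:M,
        forall i j, P i *m P j = if i == j then P i else 0,
        forall i, (P i)^T = P i,
        forall i, P i != 0 &
        \sum_i lam i *: P i = L].
Proof.
move=> Ls Uu LE.
(* Repeated eigenvalues are merged: orthogonality at distinct indices demands one projection per
   distinct eigenvalue. *)
pose rs := undup [seq d 0 k | k <- enum 'I_n.+1].
have drs k : d 0 k \in rs by rewrite mem_undup; apply: map_f; rewrite mem_enum.
have urs : uniq rs := undup_uniq _.
pose P (i : 'I_(size rs)) := horner_mx L (lagrange rs rs`_i).
have inj (A B : 'M[F]_n.+1) : toK A = toK B -> A = B.
  by move=> /matrixP AB; apply/matrixP => i j; have := AB i j; rewrite !mxE => /fmorph_inj.
(* [W g] acts as the scalar g k on the k-th column of [invmx U]. All claims except symmetry are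
   checked on such matrices and pulled back to F by [inj]. *)
pose W (g : 'I_n.+1 -> F) := invmx U *m diag_mx (toK (\row_k g k)) *m U.
have PE i : toK (P i) = W (fun k => (d 0 k == rs`_i)%:R).
  rewrite /P map_horner_mx LE horner_mx_uconjC// horner_mx_diag.
  rewrite /W; congr (_ *m diag_mx _ *m _); apply/rowP => k.
  by rewrite !mxE horner_map /= lagrangeE.
have WM g h : W g *m W h = W (fun k => g k * h k).
  rewrite /W !mulmxA mulmxK// -(mulmxA _ (diag_mx _) (diag_mx _)) mulmx_diag.
  congr (_ *m diag_mx _ *m _).
  by apply/rowP => k; rewrite !mxE rmorphM.
have Wsum (c : 'I_(size rs) -> F) (g : 'I_(size rs) -> 'I_n.+1 -> F) :
   \sum_i f (c i) *: W (g i) = W (fun k => \sum_i c i * g i k).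
  rewrite /W; under eq_bigr do rewrite scalemxAl scalemxAr.
  rewrite -mulmx_suml -mulmx_sumr; congr (_ *m _ *m _).
  apply/matrixP => x y; rewrite summxE !mxE rmorph_sum -sumrMnl.
  by apply: eq_bigr => i _; rewrite !mxE rmorphM /= mulrnAr.
have sel (g : F -> F) k : \sum_(i < size rs) g rs`_i * (d 0 k == rs`_i)%:R = g (d 0 k).
  have ik : (index (d 0%R k) rs < size rs)%N by rewrite index_mem.
  rewrite (bigD1 (Ordinal ik))//= nth_index// eqxx mulr1 big1 ?addr0// => i ni.
  case: eqP => [e|_]; last by rewrite mulr0.
  by case/eqP: ni; apply/val_inj; rewrite /= e index_uniq.
exists (size rs), (fun i => rs`_i), P; split.
- apply: inj; rewrite map_mx1 raddf_sum /=.
  under eq_bigr do rewrite PE -[W _]scale1r -(rmorph1 f).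
  rewrite (Wsum (fun=> 1)) /W (_ : toK _ = const_mx 1).
    by rewrite diag_const_mx mulmx1 mulVmx.
  by apply/rowP => k; rewrite !mxE (sel (fun=> 1)) rmorph1.
- move=> i j; apply: inj; rewrite map_mxM !PE WM.
  case: eqP => [->|/eqP nij].
    rewrite PE /W; congr (_ *m diag_mx _ *m _); apply/rowP => k; rewrite !mxE.
    by case: eqP; rewrite ?mulr1 ?mulr0.
  rewrite map_mx0 /W (_ : toK _ = 0) ?linear0 ?mulmx0 ?mul0mx//.
  apply/rowP => k; rewrite !mxE; case: eqP => [->|]; last by rewrite mul0r rmorph0.
  by rewrite nth_uniq// (_ : (i == j :> nat) = false) ?mulr0 ?rmorph0//; exact: negbTE nij.
- by move=> i; exact: trmx_horner_mx.
- move=> i; apply/eqP => /(congr1 toK); rewrite PE map_mx0 => W0.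
  have D0 : diag_mx (toK (\row_k ((d 0 k == rs`_i)%:R))) = 0.
    have := congr1 (fun X => U *m X *m invmx U) W0.
    by rewrite /W mulmx0 mul0mx !mulmxA mulmxV// mul1mx mulmxK.
  have : rs`_i \in rs by exact: mem_nth.
  rewrite mem_undup => /mapP[k _ e]; have /matrixP/(_ k k) := D0.
  by rewrite !mxE e !eqxx rmorph1 => /eqP; rewrite oner_eq0.
- apply: inj; rewrite raddf_sum /=.
  under eq_bigr do rewrite map_mxZ PE.
  rewrite Wsum LE /W; congr (_ *m diag_mx _ *m _).
  by apply/rowP => k; rewrite !mxE (sel id).
Qed.

End LagrangeResolution.

Section SpectralResolution.
Variable R : rcfType.
Notation toC := (map_mx (real_complex R)).

(** Over R[i] the matrix is hermitian and the complex spectral theorem applies. Its spectrum is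
    real, so [d] descends to R, while [U] remains complex. *)
Lemma real_symmetric_spectral n (L : 'M[R]_n.+1) : L^T = L ->
  exists (U : 'M[R[i]]_n.+1) (d : 'rV[R]_n.+1), U \in unitmx /\
    toC L = invmx U *m diag_mx (toC d) *m U.
Proof.
move=> Ls; have Lh : toC L \is hermsymmx.
  apply: realsym_hermsym.
    by rewrite qualifE /= expr0 scale1r map_mx_id// map_trmx Ls.
  by apply/mxOverP => i j; rewrite mxE complex_real.
have /hermitian_normalmx /orthomx_spectralP LE := Lh.
exists (spectralmx (toC L)), (map_mx (@complex.Re R) (spectral_diag (toC L))).
split; first exact: spectral_unit.
have -> : toC (map_mx (@complex.Re R) (spectral_diag (toC L))) = spectral_diag (toC L).
  apply/rowP => i; rewrite !mxE RRe_real//.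
  by have /mxOverP/(_ 0 i) := hermitian_spectral_diag_real Lh.
exact: LE.
Qed.

Lemma spectral_resolution n (L : 'M[R]_n.+1) : L^T = L ->
  exists (k : nat) (lam : 'I_k -> R) (P : 'I_k -> 'M[R]_n.+1),
    [/\ \sum_i P i = 1%:M,
        forall i j, P i *m P j = if i == j then P i else 0,
        forall i, (P i)^T = P i,
        forall i, P i != 0 &
        \sum_i lam i *: P i = L].
Proof.
move=> Ls; have [U [d [Uu LE]]] := real_symmetric_spectral Ls.
exact: (lagrange_resolution Ls Uu LE).
Qed.

End SpectralResolution.

(** * Functional calculus of a finite resolution of the identity *)

Section FunctionalCalculus.
Variables (S : comPzRingType) (n k : nat) (P : 'I_k -> 'M[S]_n).
Hypothesis Psum : \sum_i P i = 1%:M.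
Hypothesis Porth : forall i j, P i *m P j = if i == j then P i else 0.

(** The scalars are attached to indices of projections rather than to points of the spectrum; the
    eigenvalue family [lam] gives back the matrix itself. *)
Definition fcalc (h : 'I_k -> S) : 'M[S]_n := \sum_i h i *: P i.

Lemma fcalcE h a b : fcalc h a b = \sum_i h i * P i a b.
Proof. by rewrite summxE; apply: eq_bigr => i _; rewrite mxE. Qed.

Lemma eq_fcalc g h : g =1 h -> fcalc g = fcalc h.
Proof. by move=> gh; apply: eq_bigr => i _; rewrite gh. Qed.

Lemma fcalcM g h : fcalc g *m fcalc h = fcalc (fun i => g i * h i).
Proof.
rewrite /fcalc mulmx_suml; apply: eq_bigr => i _.
rewrite mulmx_sumr (bigD1 i)//= big1 ?addr0 => [|j ji].
  by rewrite -scalemxAl -scalemxAr scalerA Porth eqxx.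
by rewrite -scalemxAl -scalemxAr Porth eq_sym (negbTE ji) !scaler0.
Qed.

Lemma fcalc1 : fcalc (fun=> 1) = 1%:M.
Proof. by rewrite -Psum; apply: eq_bigr => i _; rewrite scale1r. Qed.

Lemma fcalcD g h : fcalc g + fcalc h = fcalc (fun i => g i + h i).
Proof. by rewrite -big_split; apply: eq_bigr => i _; rewrite scalerDl. Qed.

Lemma fcalcB g h : fcalc g - fcalc h = fcalc (fun i => g i - h i).
Proof. by rewrite -sumrB; apply: eq_bigr => i _; rewrite scalerBl. Qed.

Lemma fcalcZ c g : c *: fcalc g = fcalc (fun i => c * g i).
Proof. by rewrite scaler_sumr; apply: eq_bigr => i _; rewrite scalerA. Qed.

Lemma fcalcX g m : fcalc g ^+ m = fcalc (fun i => g i ^+ m).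
Proof.
elim: m => [|m IH]; first by rewrite expr0 -[1]/(1%:M) -fcalc1; apply: eq_fcalc.
by rewrite exprS IH -[_ * _]/(_ *m _) fcalcM; apply: eq_fcalc => i; rewrite exprS.
Qed.

Lemma trmx_fcalc g : (forall i, (P i)^T = P i) -> (fcalc g)^T = fcalc g.
Proof.
by move=> Ps; rewrite /fcalc linear_sum; apply: eq_bigr => i _; rewrite linearZ /= Ps.
Qed.

End FunctionalCalculus.

Lemma invmx_fcalc (K : fieldType) n k (P : 'I_k -> 'M[K]_n) (h : 'I_k -> K) :
  \sum_i P i = 1%:M -> (forall i j, P i *m P j = if i == j then P i else 0) ->
  (forall i, h i != 0) -> invmx (fcalc P h) = fcalc P (fun i => (h i)^-1).
Proof.
move=> Psum Porth h0.
have E : fcalc P h *m fcalc P (fun i => (h i)^-1) = 1%:M.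
  by rewrite fcalcM// -(fcalc1 Psum); apply: eq_fcalc => i; rewrite divff.
have [hu _] := mulmx1_unit E.
by rewrite -[LHS]mulmx1 -E mulKmx.
Qed.

(** * Pseudo-inverse, cosine and sine in the functional calculus *)

Section PseudoInverse.
Context {R : realType}.

(** Penrose's argument: the symmetry conditions force A X = A Y and X A = Y A, whence X = X A X = Y
    A Y = Y. It lets [mp_pinv], a mere choice, be computed by exhibiting one solution. *)
Lemma MP_inverse_unique n (A X Y : 'M[R]_n) :
  is_MP_inverse A X -> is_MP_inverse A Y -> X = Y.
Proof.
move=> [x1 x2 x3 x4] [y1 y2 y3 y4].
have AXY : A *m X = A *m Y.
  have : (A *m X *m (A *m Y))^T = A *m Y by rewrite mulmxA x1 y3.
  by rewrite trmx_mul y3 x3 mulmxA y1.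
have XAY : X *m A = Y *m A.
  have : (X *m A *m (Y *m A))^T = X *m A by rewrite -mulmxA (mulmxA A) y1 x4.
  by rewrite trmx_mul y4 x4 -mulmxA (mulmxA A) x1.
by rewrite -x2 XAY -mulmxA AXY mulmxA y2.
Qed.

Lemma mp_pinvE n (A X : 'M[R]_n) : is_MP_inverse A X -> mp_pinv A = X.
Proof.
move=> AX; rewrite /mp_pinv; apply: (@xget_unique _ _ [set X | is_MP_inverse A X]) => //.
by move=> Y AY; exact: MP_inverse_unique AY AX.
Qed.

Variables (n k : nat) (P : 'I_k -> 'M[R]_n).
Hypothesis Psum : \sum_i P i = 1%:M.
Hypothesis Porth : forall i j, P i *m P j = if i == j then P i else 0.
Hypothesis Psym : forall i, (P i)^T = P i.

(** The convention 0^-1 = 0 is what a pseudo-inverse does on the kernel. *)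
Lemma mp_pinv_fcalc h : mp_pinv (fcalc P h) = fcalc P (fun i => (h i)^-1).
Proof.
have hK (x : R) : x * x^-1 * x = x.
  by have [->|x0] := eqVneq x 0; rewrite ?mul0r// divff// mul1r.
have hK' (x : R) : x^-1 * x * x^-1 = x^-1.
  by have [->|x0] := eqVneq x 0; rewrite ?invr0 ?mul0r// mulVf// mul1r.
apply: mp_pinvE; split; rewrite !fcalcM// ?trmx_fcalc//.
- exact: eq_fcalc.
- exact: eq_fcalc.
Qed.

(** [m] lists the exponents, even for the cosine and odd for the sine. Powers act on each projection
    separately, so an entry of the series is a finite combination of scalar series. *)
Lemma lim_series_fcalc (c : nat -> R) (m : nat -> nat) (h : 'I_k -> R) (l : 'I_k -> R) a b :
  (forall i, series (fun j => c j * h i ^+ m j) @ \oo --> l i) ->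
  limn (series (fun j => c j * (fcalc P h ^+ m j) a b)) = fcalc P l a b.
Proof.
move=> hl; apply/cvg_lim => //.
rewrite (_ : series _ = (fun N => \sum_i series (fun j => c j * h i ^+ m j) N * P i a b)).
  rewrite fcalcE; apply: cvg_big => //; first exact: add_continuous.
  by move=> i _; apply: cvgM; [exact: hl|exact: cvg_cst].
apply/funext => N; rewrite /series /=.
under eq_bigr do rewrite fcalcX// fcalcE mulr_sumr.
rewrite exchange_big /=; apply: eq_bigr => i _; rewrite mulr_suml.
by apply: eq_bigr => j _; rewrite mulrA.
Qed.

Lemma mx_cos_fcalc h : mx_cos (fcalc P h) = fcalc P (fun i => cos (h i)).
Proof.
apply/matrixP => a b; rewrite mxE; apply: (lim_series_fcalc (m := fun j => (2 * j)%N)) => i.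
rewrite (_ : (fun j => _) = cos_coeff' (h i)); first exact: cvg_cos_coeff'.
by apply/funext => j; rewrite /cos_coeff' mul2n mulrAC.
Qed.

Lemma mx_sin_fcalc h : mx_sin (fcalc P h) = fcalc P (fun i => sin (h i)).
Proof.
apply/matrixP => a b; rewrite mxE; apply: (lim_series_fcalc (m := fun j => (2 * j).+1%N)) => i.
rewrite (_ : (fun j => _) = sin_coeff' (h i)); first exact: cvg_sin_coeff'.
by apply/funext => j; rewrite /sin_coeff' mul2n mulrAC.
Qed.

End PseudoInverse.
(** * Weighted Laplacians and network performance *)

Section Laplacian.
Context {R : realType}.
Variables (n m : nat) (ends : 'I_m -> 'I_n * 'I_n) (w : 'I_m -> R).

Lemma trmx_lap : (lap ends w)^T = lap ends w.
Proof.
rewrite /lap linear_sum; apply: eq_bigr => e _.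
by rewrite linearZ /= trmx_mul trmxK.
Qed.

Lemma Ecol_mul e (v : 'cV[R]_n) :
  (Ecol R ends e)^T *m v = (v (ends e).1 0 - v (ends e).2 0)%:M.
Proof.
apply/matrixP => i j; rewrite !ord1 !mxE eqxx mulr1n.
have pick a : \sum_(k < n) (k == a)%:R * v k 0 = v a 0.
  rewrite (bigD1 a)//= eqxx mul1r big1 ?addr0// => k /negbTE ->.
  by rewrite mul0r.
rewrite -!pick -sumrB; apply: eq_bigr => k _.
by rewrite !mxE mulrBl.
Qed.

Lemma lap_mul (v : 'cV[R]_n) : lap ends w *m v =
  \sum_(e < m) (w e * (v (ends e).1 0 - v (ends e).2 0)) *: Ecol R ends e.
Proof.
rewrite /lap mulmx_suml; apply: eq_bigr => e _.
by rewrite -scalemxAl -mulmxA Ecol_mul mul_mx_scalar scalerA.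
Qed.

Lemma lap_quad (v : 'cV[R]_n) : (v^T *m (lap ends w *m v)) 0 0 =
  \sum_(e < m) w e * (v (ends e).1 0 - v (ends e).2 0) ^+ 2.
Proof.
rewrite lap_mul mulmx_sumr summxE; apply: eq_bigr => e _.
rewrite -scalemxAr -[v^T *m _]trmxK trmx_mul trmxK Ecol_mul tr_scalar_mx.
by rewrite !mxE eqxx mulr1n expr2 mulrA.
Qed.

Lemma dot_ge0 (v : 'cV[R]_n) : 0 <= (v^T *m v) 0 0.
Proof. by rewrite mxE sumr_ge0// => i _; rewrite mxE -expr2 sqr_ge0. Qed.

Lemma dot_gt0 (v : 'cV[R]_n) : v != 0 -> 0 < (v^T *m v) 0 0.
Proof.
move=> v0; rewrite lt_def dot_ge0 andbT; apply: contraNneq v0.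
rewrite mxE => /eqP; rewrite psumr_eq0 => [/allP h|i _]; last first.
  by rewrite mxE -expr2 sqr_ge0.
apply/eqP/colP => i; have := h i (mem_index_enum _).
by rewrite !mxE -expr2 sqrf_eq0 => /eqP.
Qed.

Hypothesis w_gt0 : forall e, 0 < w e.

Lemma lap_quad_ge0 (v : 'cV[R]_n) : 0 <= (v^T *m (lap ends w *m v)) 0 0.
Proof. by rewrite lap_quad sumr_ge0// => e _; rewrite mulr_ge0 ?sqr_ge0// ltW. Qed.

Hypothesis conn : connected_graph ends.

(** The quadratic form is a sum of nonnegative terms, so each vanishes: [v] agrees at the two ends
    of every link, and connectedness propagates this along paths. *)
Lemma lap_kernel (v : 'cV[R]_n) : lap ends w *m v = 0 -> forall i j, v i 0 = v j 0.
Proof.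
move=> Lv; have : (v^T *m (lap ends w *m v)) 0 0 = 0 by rewrite Lv mulmx0 mxE.
rewrite lap_quad => /eqP; rewrite psumr_eq0 => [/allP h|e _]; last first.
  by rewrite mulr_ge0 ?sqr_ge0// ltW.
have he e : v (ends e).1 0 = v (ends e).2 0.
  have := h e (mem_index_enum _); rewrite /= mulf_eq0 gt_eqF//= sqrf_eq0 subr_eq0.
  by move/eqP.
move=> i j; have /connectP[p pp ->] := conn i j.
elim: p i pp => //= x p IH i /andP[/existsP[e /orP[/eqP ie|/eqP ie]] pp].
- by rewrite -(IH x pp); have := he e; rewrite ie.
- by rewrite -(IH x pp); have := he e; rewrite ie.
Qed.

Lemma lap_ones : lap ends w *m const_mx 1 = 0 :> 'cV[R]_n.
Proof. by rewrite lap_mul big1// => e _; rewrite !mxE subrr mulr0 scale0r. Qed.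

End Laplacian.

(** * Spectral projections of a connected weighted Laplacian *)

Section LaplacianResolution.
Context {R : realType}.
Variables (n m : nat) (ends : 'I_m -> 'I_n * 'I_n) (w : 'I_m -> R).
Hypothesis n_gt0 : (0 < n)%N.
Hypothesis w_gt0 : forall e, 0 < w e.
Hypothesis conn : connected_graph ends.
Variables (k : nat) (lam : 'I_k -> R) (P : 'I_k -> 'M[R]_n).
Hypothesis Psum : \sum_i P i = 1%:M.
Hypothesis Porth : forall i j, P i *m P j = if i == j then P i else 0.
Hypothesis Psym : forall i, (P i)^T = P i.
Hypothesis Pn0 : forall i, P i != 0.
Hypothesis PL : fcalc P lam = lap ends w.

Let LP i : lap ends w *m P i = lam i *: P i.
Proof.
rewrite -PL /fcalc mulmx_suml (bigD1 i)//= big1 ?addr0 => [|j ji].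
  by rewrite -scalemxAl Porth eqxx.
by rewrite -scalemxAl Porth (negbTE ji) scaler0.
Qed.

Let PL' i : P i *m lap ends w = lam i *: P i.
Proof. by rewrite -[LHS]trmxK trmx_mul trmx_lap Psym LP linearZ /= Psym. Qed.

Lemma proj_diag_ge0 i j : 0 <= P i j j.
Proof.
have -> : P i = P i *m P i by rewrite Porth eqxx.
rewrite mxE sumr_ge0// => l _.
by rewrite -{1}(Psym i) mxE -expr2 sqr_ge0.
Qed.

(** A nonzero column of [P i] is an eigenvector, on which the quadratic form is nonnegative. *)
Lemma lap_eigen_ge0 i : 0 <= lam i.
Proof.
have [j cj] : exists j, col j (P i) != 0.
  apply/not_existsP => h; case/eqP: (Pn0 i); apply/matrixP => a b.
  have /negP := h b; rewrite negbK => /eqP/colP/(_ a).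
  by rewrite !mxE.
have Lc : lap ends w *m col j (P i) = lam i *: col j (P i).
  by rewrite colE mulmxA LP -scalemxAl.
have := lap_quad_ge0 ends w_gt0 (col j (P i)).
rewrite Lc -scalemxAr mxE pmulr_lge0//.
exact: dot_gt0.
Qed.

Lemma lap_eigenvalue i : eigenvalue (lap ends w) (lam i).
Proof.
have [j rj] : exists j, row j (P i) != 0.
  apply/not_existsP => h; case/eqP: (Pn0 i); apply/row_matrixP => a.
  by have /negP := h a; rewrite negbK row0 => /eqP.
apply/eigenvalueP; exists (row j (P i)) => //.
by rewrite -row_mul PL'; apply/rowP => a; rewrite !mxE.
Qed.

Lemma lap_eigenvalueP (x : R) : eigenvalue (lap ends w) x -> exists i, x = lam i.
Proof.
move=> /eigenvalueP[v vL v0].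
have [i vi] : exists i, v *m P i != 0.
  apply/not_existsP => h; case/eqP: v0.
  rewrite -[v]mulmx1 -Psum mulmx_sumr big1// => i _.
  by have /negP := h i; rewrite negbK => /eqP.
exists i; apply/eqP; rewrite -subr_eq0; move: vi; apply: contraNT => xl.
have : (x - lam i) *: (v *m P i) = 0.
  rewrite scalerBl scalemxAl -vL -mulmxA LP -scalemxAr subrr//.
by move/eqP; rewrite scaler_eq0 (negbTE xl).
Qed.

(** [lambda_max] is a supremum, so the spectrum must first be seen to be bounded; this holds because
    [lam] lists it. *)
Lemma lap_eigen_le_max i : lam i <= lambda_max (lap ends w).
Proof.
apply: ub_le_sup; last exact: lap_eigenvalue.
exists (\sum_j `|lam j|) => x /lap_eigenvalueP[j ->].
rewrite (bigD1 j)//= (le_trans (ler_norm _))// lerDl sumr_ge0//.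
Qed.

(** [Q] projects onto the kernel. By connectedness its columns are constant, by symmetry so are its
    rows, and since it fixes the all-ones vector every entry is 1 / n. *)
Lemma Mn_fcalc : Mn R n = fcalc P (fun i => (lam i != 0)%:R).
Proof.
pose Q := fcalc P (fun i => (lam i == 0)%:R).
have Q1 : 1%:M - Q = fcalc P (fun i => (lam i != 0)%:R).
  rewrite -(fcalc1 Psum) fcalcB; apply: eq_fcalc => i.
  by case: (lam i == 0); rewrite ?subrr ?subr0.
have LQ : lap ends w *m Q = 0.
  rewrite -PL fcalcM// /fcalc big1// => i _.
  by case: eqP => [->|_]; rewrite ?mul0r ?mulr0 scale0r.
have Qsym : Q^T = Q by apply: trmx_fcalc.
have Qrow a b c : Q a c = Q b c.
  have := @lap_kernel R n m ends w w_gt0 conn (col c Q) _ a b.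
  by rewrite {1}colE mulmxA LQ mul0mx => /(_ erefl); rewrite !mxE.
have Qcol a b c : Q c a = Q c b.
  by rewrite -Qsym !mxE; exact: Qrow.
have Qone : Q *m const_mx 1 = const_mx 1 :> 'cV_n.
  have Pone i : lam i != 0 -> P i *m const_mx 1 = 0 :> 'cV_n.
    move=> l0; apply/eqP; move/eqP: (congr1 (mulmx (P i)) (@lap_ones R n m ends w)).
    by rewrite mulmxA PL' mulmx0 -scalemxAl scaler_eq0 (negbTE l0).
  rewrite -[RHS]mul1mx -(fcalc1 Psum) /Q /fcalc !mulmx_suml; apply: eq_bigr => i _.
  rewrite -!scalemxAl; have [_|l0] := eqVneq (lam i) 0; first by [].
  by rewrite Pone// !scaler0.
rewrite -Q1 /Mn; congr (_ - _); apply/matrixP => a b; rewrite !mxE mulr1.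
have /colP/(_ a) := Qone; rewrite !mxE.
under eq_bigr => c _ do rewrite (Qcol c b a) !mxE mulr1.
rewrite sumr_const card_ord => h.
have n0 : n%:R != 0 :> R by rewrite pnatr_eq0 -lt0n.
by apply: (mulIf n0); rewrite mulVf// mulr_natr.
Qed.

End LaplacianResolution.

(** * The transfer matrix and its trace, mode by mode *)

Section TransferTrace.
Context {R : realType}.
Variables (n k : nat) (lam : 'I_k -> R) (P : 'I_k -> 'M[R]_n).
Hypothesis Psum : \sum_i P i = 1%:M.
Hypothesis Porth : forall i j, P i *m P j = if i == j then P i else 0.
Hypothesis Psym : forall i, (P i)^T = P i.
Variable tau : R.
Hypotheses (tau_ge0 : 0 <= tau) (lam_ge0 : forall i, 0 <= lam i)
  (lam_stable : forall i, tau * lam i < pi / 2).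
Hypothesis MnE : Mn R n = fcalc P (fun i => (lam i != 0)%:R).

Notation toC := (map_mx (fun x : R => x%:C)).

Let PC i : 'M[R[i]]_n := toC (P i).

Let PCsum : \sum_i PC i = 1%:M.
Proof.
have := congr1 (map_mx (real_complex R)) Psum.
by rewrite map_mx1 raddf_sum.
Qed.

Let PCorth i j : PC i *m PC j = if i == j then PC i else 0.
Proof.
have := congr1 (map_mx (real_complex R)) (Porth i j).
by rewrite map_mxM; case: eqP => // _; rewrite map_mx0.
Qed.

Lemma map_fcalc h : toC (fcalc P h) = fcalc PC (fun i => (h i)%:C).
Proof.
have -> : toC (fcalc P h) = map_mx (real_complex R) (fcalc P h) by [].
by rewrite /fcalc raddf_sum /=; apply: eq_bigr => i _; rewrite map_mxZ.
Qed.

(** The eigenvalue of s I + exp (- tau s) L at s = i om that belongs to the eigenvalue [l] of L. *)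
Definition mode (om l : R) : R[i] :=
  Complex 0 om + Complex (cos (tau * om)) (- sin (tau * om)) * l%:C.

Lemma mode_mul_conj om l : mode om l * conjc (mode om l) = (mode_sq tau l om)%:C.
Proof.
apply/eqP; rewrite eq_complex /mode /mode_sq /=.
have := cos2Dsin2 (tau * om); move: (cos _) (sin _) => C S CS.
apply/andP; split; apply/eqP; last by ring.
have -> : l ^+ 2 = (C ^+ 2 + S ^+ 2) * l ^+ 2 by rewrite CS mul1r.
by ring.
Qed.

Lemma mode_neq0 om l : om != 0 -> 0 <= l -> tau * l < pi / 2 -> mode om l != 0.
Proof.
move=> om0 l0 tl; apply/eqP => z0.
have := mode_mul_conj om l; rewrite z0 mul0r => /esym/eqP.
rewrite eq_complex /= eqxx andbT; apply/negP.
move: l0; rewrite le_eqVlt => /predU1P[<-|l0]; last by rewrite gt_eqF// mode_sq_gt0.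
by rewrite /mode_sq mulr0 !mul0r subr0 expr0n addr0 expf_neq0.
Qed.

(** The condition on [om] makes the mode of eigenvalue 0, equal to i om, invertible; the factor from
    [Mn] then removes that mode. *)
Lemma transferE sigma om : om != 0 ->
  transfer tau (fcalc P lam) sigma om =
  fcalc PC (fun i => (lam i != 0)%:R * (mode om (lam i))^-1) *m
    diag_mx (\row_i (sigma i)%:C).
Proof.
move=> om0; rewrite /transfer MnE !map_fcalc; congr (_ *m _).
have -> : (Complex 0 om)%:M + Complex (cos (tau * om)) (- sin (tau * om)) *:
   fcalc PC (fun i => (lam i)%:C) = fcalc PC (fun i => mode om (lam i)).
  rewrite -scalemx1 -(fcalc1 PCsum) !fcalcZ fcalcD; apply: eq_fcalc => i.
  by rewrite mulr1.
rewrite (invmx_fcalc PCsum PCorth) => [|i]; last exact: mode_neq0.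
rewrite (fcalcM PCorth); apply: eq_fcalc => i; congr (_ * _).
by case: eqP.
Qed.

(** Orthogonality of the projections kills the cross terms of G^H G, leaving 1 / |mode|^2 on each;
    the diagonal noise factors on both sides weight the j-th diagonal entry by sigma_j^2. *)
Lemma Re_trace_transfer sigma om : om != 0 ->
  Re (\tr ((map_mx conjc (transfer tau (fcalc P lam) sigma om))^T *m
     transfer tau (fcalc P lam) sigma om)) =
  \sum_i (\sum_j sigma j ^+ 2 * P i j j) * ((lam i != 0)%:R * (mode_sq tau (lam i) om)^-1).
Proof.
move=> om0; rewrite transferE//.
set g := (fun i => _ * (mode _ _)^-1); set D := diag_mx _.
have cG : map_mx conjc (fcalc PC g) = fcalc PC (fun i => conjc (g i)).
  rewrite /fcalc raddf_sum /=; apply: eq_bigr => i _; rewrite map_mxZ; congr (_ *: _).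
  by apply/matrixP => a b; rewrite !mxE /= oppr0.
have cD : map_mx conjc D = D.
  by apply/matrixP => a b; rewrite !mxE rmorphMn /= oppr0.
have PCsym i : (PC i)^T = PC i by rewrite /PC map_trmx Psym.
rewrite map_mxM cG cD trmx_mul (trmx_fcalc _ PCsym) tr_diag_mx.
rewrite -mulmxA (mulmxA _ _ D) (fcalcM PCorth).
set h := (fun i => _ * _).
have hE i : h i = ((lam i != 0)%:R * (mode_sq tau (lam i) om)^-1)%:C.
  have cg : conjc (g i) = (lam i != 0)%:R * (conjc (mode om (lam i)))^-1.
    by rewrite /g rmorphM rmorph_nat fmorphV.
  have mV : (conjc (mode om (lam i)))^-1 * (mode om (lam i))^-1 =
      ((mode_sq tau (lam i) om)^-1)%:C.
    by rewrite -invfM mulrC mode_mul_conj fmorphV.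
  rewrite /h cg /g mulrACA mV.
  by case: (lam i == 0); rewrite ?mul0r ?mul1r ?rmorph0.
have -> : \tr (D *m (fcalc PC h *m D)) =
   (\sum_i (\sum_j sigma j ^+ 2 * P i j j) * ((lam i != 0)%:R * (mode_sq tau (lam i) om)^-1))%:C.
  rewrite /mxtrace rmorph_sum /=.
  under [RHS]eq_bigr do rewrite rmorphM rmorph_sum mulr_suml.
  rewrite exchange_big /=; apply: eq_bigr => j _.
  rewrite mul_diag_mx mul_mx_diag !mxE fcalcE mulr_suml mulr_sumr.
  apply: eq_bigr => i _; rewrite hE !mxE.
  by rewrite -!rmorphM expr2; congr (real_complex R _); ring.
by [].
Qed.

End TransferTrace.

(** * Performance as a linear form in the noise powers *)

Section Performance.
Context {R : realType}.
Notation mu := (@lebesgue_measure R).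

(** For a stable mode with l > 0, the frequency integral of 1 / [mode_sq] divided by pi; the
    unobserved mode l = 0 counts for nothing. *)
Definition mode_gain (tau l : R) : R :=
  (l != 0)%:R * (l^-1 * (cos (tau * l) / (1 - sin (tau * l)))).

Lemma rho_ss_fcalc n k (lam : 'I_k -> R) (P : 'I_k -> 'M[R]_n) (tau : R) (sigma : 'I_n -> R) :
  \sum_i P i = 1%:M -> (forall i j, P i *m P j = if i == j then P i else 0) ->
  (forall i, (P i)^T = P i) -> 0 <= tau -> (forall i, 0 <= lam i) ->
  (forall i, tau * lam i < pi / 2) ->
  Mn R n = fcalc P (fun i => (lam i != 0)%:R) ->
  (forall i j, 0 <= P i j j) ->
  rho_ss (fcalc P lam) tau sigma =
  (\sum_j sigma j ^+ 2 * (2^-1 * \sum_i mode_gain tau (lam i) * P i j j))%:E.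
Proof.
move=> Psum Porth Psym t0 l0 tl MnE Pd.
pose c i := \sum_j sigma j ^+ 2 * P i j j.
have c0 i : 0 <= c i by apply: sumr_ge0 => j _; rewrite mulr_ge0 ?sqr_ge0.
pose g i (om : R) := (lam i != 0)%:R * (mode_sq tau (lam i) om)^-1.
have gm i : measurable_fun setT (fun om => (g i om)%:E).
  apply/measurable_EFinP; apply: continuous_measurable_fun.
  rewrite /g; have [li|li] := eqVneq (lam i) 0.
    by under eq_fun do rewrite mul0r; exact: cst_continuous.
  under eq_fun do rewrite mul1r.
  by apply: continuous_mode_sqV => //; rewrite lt_def li l0.
have g0 i om : 0 <= g i om.
  rewrite /g; have [li|li] := eqVneq (lam i) 0; first by rewrite mul0r.
  by rewrite mul1r invr_ge0 ltW// mode_sq_gt0// lt_def li l0.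
have gi i : (\int[mu]_om (g i om)%:E = (pi * mode_gain tau (lam i))%:E)%E.
  rewrite /g /mode_gain; have [li|li] := eqVneq (lam i) 0.
    by rewrite mul0r mulr0; under eq_integral do rewrite mul0r; rewrite integral0.
  rewrite mul1r; under eq_integral do rewrite mul1r.
  by apply: integral_mode_sqV => //; rewrite lt_def li l0.
rewrite /rho_ss.
have -> : (\int[mu]_(om in [set: R]) (Re (\tr ((map_mx conjc
     (transfer tau (fcalc P lam) sigma om))^T *m transfer tau (fcalc P lam) sigma om)))%:E)%E =
   (\int[mu]_(om in [set: R]) (\sum_i ((c i)%:E * (g i om)%:E)))%E.
  set F := (X in (\int[mu]_(om in _) X om)%E).
  (* The modal formula is available only for nonzero frequencies, so the null set {0} is removed
     from both integrals. *)
  have FE om : om \in [set: R] `\ 0 -> F om = (\sum_i ((c i)%:E * (g i om)%:E))%E.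
    rewrite inE => -[_ /= /eqP om0].
    by rewrite /F Re_trace_transfer// -sumEFin; apply: eq_bigr => i _; rewrite -EFinM.
  have mS (D : set R) : measurable_fun D (fun om => (\sum_i ((c i)%:E * (g i om)%:E))%E).
    apply: emeasurable_sum => i; apply: measurable_funeM.
    exact: measurable_funTS.
  have mD : measurable ([set: R] `\ 0) by exact: measurableD.
  rewrite -(@integral_setD1 R F 0)//; last by apply: eq_measurable_fun (mS _) => om /FE.
  rewrite -(@integral_setD1 R (fun om => (\sum_i ((c i)%:E * (g i om)%:E))%E) 0 setT)//.
  by apply: eq_integral => om; exact: FE.
rewrite ge0_integral_sum//; last 2 first.
- by move=> i; apply: measurable_funeM; exact: gm.
- by move=> i om _; rewrite mule_ge0 ?lee_fin.
have ZE i : (\int[mu]_om ((c i)%:E * (g i om)%:E) = (c i * (pi * mode_gain tau (lam i)))%:E)%E.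
  rewrite ge0_integralZl ?lee_fin ?gi//; first exact: gm.
  by move=> om _; rewrite lee_fin.
under eq_bigr do rewrite ZE.
rewrite sumEFin -EFinM; congr EFin.
rewrite mulr_sumr; under [RHS]eq_bigr do rewrite mulrA mulr_sumr.
rewrite exchange_big /=; apply: eq_bigr => i _.
rewrite /c mulr_suml mulr_sumr; apply: eq_bigr => j _.
have : (pi : R) != 0 by rewrite gt_eqF// pi_gt0.
by move: (pi : R) => p p0; field.
Qed.

(** Collects the spectral facts that the performance formulas consume; stability of every mode
    follows from admissibility, since each eigenvalue is at most [lambda_max]. *)
Lemma network_resolution n m (ends : 'I_m -> 'I_n * 'I_n) (tau : R) (w : 'I_m -> R) :
  (0 < n)%N -> connected_graph ends -> 0 <= tau -> admissible ends tau w ->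
  exists (k : nat) (lam : 'I_k -> R) (P : 'I_k -> 'M[R]_n),
    [/\ \sum_i P i = 1%:M,
        forall i j, P i *m P j = if i == j then P i else 0,
        forall i, (P i)^T = P i,
        fcalc P lam = lap ends w &
        [/\ forall i, 0 <= lam i, forall i, tau * lam i < pi / 2,
            forall i j, 0 <= P i j j &
            Mn R n = fcalc P (fun i => (lam i != 0)%:R)]].
Proof.
case: n ends => // n ends n0 conn t0 [w0 tmax].
have [k [lam [P [Psum Porth Psym Pn0 PL]]]] := spectral_resolution (trmx_lap ends w).
exists k, lam, P; split=> //; split.
- move=> i; exact: (lap_eigen_ge0 w0 Porth Pn0 PL).
- move=> i; apply: le_lt_trans tmax; apply: ler_wpM2l => //.
  exact: (lap_eigen_le_max Psum Porth Psym Pn0 PL).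
- by move=> i j; exact: (proj_diag_ge0 Porth Psym).
- exact: (Mn_fcalc n0 w0 conn Psum Porth Psym PL).
Qed.

Lemma rho_ss_eta n m (ends : 'I_m -> 'I_n * 'I_n) (tau : R) (w : 'I_m -> R) sigma :
  (0 < n)%N -> connected_graph ends -> 0 <= tau -> admissible ends tau w ->
  rho_ss (lap ends w) tau sigma = (\sum_j sigma j ^+ 2 * Defs.eta ends tau w j)%:E.
Proof.
move=> n0 conn t0 adm.
have [k [lam [P [Psum Porth Psym PL [l0 tl Pd MnE]]]]] := network_resolution n0 conn t0 adm.
rewrite -PL (rho_ss_fcalc _ Psum Porth Psym t0 l0 tl MnE Pd); congr EFin.
apply: eq_bigr => j _; congr (_ * _); rewrite /Defs.eta -PL; congr (_ * _).
rewrite fcalcZ mx_cos_fcalc// mx_sin_fcalc// MnE fcalcB !mp_pinv_fcalc// !fcalcM// fcalcE.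
apply: eq_bigr => i _; congr (_ * _); rewrite /mode_gain.
(* At eigenvalue 0 both sides vanish, the pseudo-inverse of the Laplacian contributing 0^-1 = 0. *)
by have [->|li] := eqVneq (lam i) 0; rewrite ?mul0r ?invr0 ?mul0r// !mul1r mulrA.
Qed.

(** A linear form in the powers sigma_j^2, nonnegative with total n, is largest when all power sits
    at an agent of maximal centrality. *)
Lemma worst_rho_max_eta n m (ends : 'I_m -> 'I_n * 'I_n) (tau : R) (w : 'I_m -> R) :
  (0 < n)%N -> connected_graph ends -> 0 <= tau -> admissible ends tau w ->
  worst_rho ends tau w = (n%:R * max_eta ends tau w)%:E.
Proof.
move=> n0 conn t0 adm.
have bnd : has_ubound (range (Defs.eta ends tau w)).
  exists (\sum_j `|Defs.eta ends tau w j|) => _ [j _ <-].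
  by rewrite (bigD1 j)//= (le_trans (ler_norm _))// lerDl sumr_ge0.
have ne : range (Defs.eta ends tau w) !=set0 by exists (Defs.eta ends tau w (Ordinal n0)), (Ordinal n0).
apply/eqP; rewrite eq_le; apply/andP; split.
  apply: ub_ereal_sup => _ [s [s0 s1] <-]; rewrite rho_ss_eta// lee_fin.
  rewrite -s1 mulr_suml; apply: ler_sum => j _.
  by apply: ler_wpM2l; [exact: sqr_ge0|apply: ub_le_sup => //; exists j].
have le_worst j : ((n%:R * Defs.eta ends tau w j)%:E <= worst_rho ends tau w)%E.
  (* all the noise power on agent j *)
  pose s (l : 'I_n) : R := Num.sqrt n%:R * (l == j)%:R.
  have s2 (h : 'I_n -> R) : \sum_l s l ^+ 2 * h l = n%:R * h j.
    rewrite (bigD1 j)//= big1 ?addr0 => [|l /negbTE lj].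
      by rewrite /s eqxx mulr1 sqr_sqrtr.
    by rewrite /s lj mulr0 expr0n mul0r.
  apply: ereal_sup_ubound; exists s; last by rewrite rho_ss_eta// s2.
  split; first by move=> l; rewrite mulr_ge0// sqrtr_ge0.
  by rewrite -[RHS]mulr1 -(s2 (fun=> 1)); apply: eq_bigr => l _; rewrite mulr1.
(* The supremum over the finite nonempty set of agents is attained, so one concentrated allocation
   realises it. *)
have [j0 hj0] : exists j0, forall j, Defs.eta ends tau w j <= Defs.eta ends tau w j0.
  exists [arg max_(j > Ordinal n0) Defs.eta ends tau w j]%O.
  by case: arg_maxP => // j0 _ h j; exact: h.
apply: le_trans (le_worst j0); rewrite lee_fin; apply: ler_wpM2l => //.
by apply: ge_sup => // _ [j _ <-].
Qed.

End Performance.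
(** On admissible weights the two objectives differ by the positive factor n, so comparing one
    amounts to comparing the other. *)
Theorem theorem14 (R : realType) (n m : nat) (ends : 'I_m -> 'I_n * 'I_n) (tau : R) :
  (0 < n)%N -> simple_graph ends -> connected_graph ends -> 0 <= tau ->
  forall w : 'I_m -> R, admissible ends tau w ->
    (P1_optimal ends tau w <-> P2_optimal ends tau w).
Proof.
move=> n0 _ conn t0 w adm.
have iff w' : admissible ends tau w' ->
    (worst_rho ends tau w <= worst_rho ends tau w')%E =
    (max_eta ends tau w <= max_eta ends tau w').
  by move=> adm'; rewrite !worst_rho_max_eta// lee_fin ler_pM2l ?ltr0n.
split=> -[_ opt]; (split; first exact: adm) => w' adm'.
  by rewrite (iff w' adm'); exact: opt.
by rewrite -(iff w' adm'); exact: opt.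
Qed.
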